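(* Let $Q$ be a cyclic hyperbolic quadrilateral with side lengths $a,b,c,d$. Then the area $S=S(Q)$ is given by the formula $$\sin^2\frac{S}{4}=\frac{\sinh\frac{s-a}{2}\sinh\frac{s-b}{2}\sinh\frac{s-c}{2}\sinh\frac{s-d}{2}}{\cosh\frac{a}{2}\cosh\frac{b}{2}\cosh\frac{c}{2}\cosh\frac{d}{2}},$$ where $s=\frac{a+b+c+d}{2}$.
   Context: The hyperbolic plane carries the Riemannian metric of constant curvature $-1$. A cyclic polygon in the hyperbolic plane is a convex polygon inscribed in a circle, a horocycle, or one branch of an equidistant curve. *)

(* Defs.v *)
From HB Require Import structures.
From mathcomp Require Import all_boot all_order all_algebra.
From mathcomp Require Import all_classical all_reals all_analysis.

Set Implicit Arguments.
Unset Strict Implicit.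
Unset Printing Implicit Defensive.

Import Order.TTheory GRing.Theory Num.Theory.
Import numFieldNormedType.Exports.

Local Open Scope classical_set_scope.
Local Open Scope ring_scope.

(* The hyperbolic plane is the upper half-plane [uhp] in R * R, with the
   Riemannian metric (dx^2 + dy^2) / y^2 of constant curvature -1. *)

Section HyperbolicPlane.
Variable R : realType.
Implicit Types (p q z : R * R).

Definition sinh (x : R) : R := (expR x - expR (- x)) / 2.
Definition cosh (x : R) : R := (expR x + expR (- x)) / 2.

Definition uhp : set (R * R) := [set z | 0 < z.2].

Definition C1 (f : R -> R) : Prop :=
  (forall t, derivable f t 1) /\ continuous (derive1 f).

(* A C1 path on [0, 1] extends to a C1 path on R, so asking for C1 coordinate
   functions on all of R is no restriction; only the part over [0, 1] is
   required to lie in the half-plane. *)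
Definition hpath p q (x y : R -> R) : Prop :=
  [/\ C1 x, C1 y, (x 0, y 0) = p, (x 1, y 1) = q
    & forall t, 0 <= t <= 1 -> uhp (x t, y t)].

Definition hlength (x y : R -> R) : R :=
  \int[lebesgue_measure]_(t in `[0, 1])
     (Num.sqrt (derive1 x t ^+ 2 + derive1 y t ^+ 2) / y t).

Definition hdist p q : R :=
  inf [set L | exists x y, hpath p q x y /\ L = hlength x y].

(* dx dy / y^2 is the Riemannian area form. *)
Definition harea (Q : set (R * R)) : R :=
  \int[(lebesgue_measure \x lebesgue_measure)%E]_(z in Q) (z.2 ^+ 2)^-1.

(* The hyperbolic lines: vertical half-lines x = c, and half-circles
   (x - c)^2 + y^2 = r^2 centred on the real axis. *)
Variant hline : Type :=
| Vertical of R
| Semicircle of R & {posnum R}.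

(* Vanishes exactly on the line; its sign distinguishes the two half-planes
   bounded by the line. *)
Definition hside (l : hline) z : R :=
  match l with
  | Vertical c => z.1 - c
  | Semicircle c r => (z.1 - c) ^+ 2 + z.2 ^+ 2 - r%:num ^+ 2
  end.

Definition on_hline (l : hline) : set (R * R) :=
  [set z | uhp z /\ hside l z = 0].

Definition hdist_line z (l : hline) : R :=
  inf [set hdist z w | w in on_hline l].

Definition hcircle (C : set (R * R)) : Prop :=
  exists o r, [/\ uhp o, 0 < r & C = [set z | uhp z /\ hdist o z = r]].

(* The horocycles centred at the point at infinity are the horizontal lines;
   the one centred at (c, 0) is a Euclidean circle tangent to the real axis
   at (c, 0), without the point of tangency. *)
Definition horocycle (C : set (R * R)) : Prop :=
  (exists2 k, 0 < k & C = [set z | z.2 = k]) \/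
  (exists c r, 0 < r /\
     C = [set z | uhp z /\ (z.1 - c) ^+ 2 + (z.2 - r) ^+ 2 = r ^+ 2]).

(* The points at distance h from a line, on one side of it (given by b). *)
Definition equidistant_branch (C : set (R * R)) : Prop :=
  exists l h (b : bool), 0 < h /\
    C = [set z | [/\ uhp z, hdist_line z l = h & 0 < (-1) ^+ b * hside l z]].

Section Polygons.
Variable n : nat.
Implicit Type P : 'I_n -> R * R.

(* P lists the vertices of a convex n-gon (n >= 3) in cyclic order: for every
   side, all the other vertices lie strictly on the same side of the line
   through it. *)
Definition convex_polygon P : Prop :=
  (forall i, uhp (P i)) /\
  (forall i, exists l,
     [/\ on_hline l (P i), on_hline l (P (ordS i))
       & forall j k, j \notin [:: i; ordS i] -> k \notin [:: i; ordS i] ->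
           0 < hside l (P j) * hside l (P k)]).

(* The intersection of the closed half-planes that are bounded by the lines
   through the sides and contain the vertices. *)
Definition polygon_region P : set (R * R) :=
  [set z | uhp z /\
     forall i l, on_hline l (P i) -> on_hline l (P (ordS i)) ->
       forall j, 0 <= hside l z * hside l (P j)].

Definition cyclic_polygon P : Prop :=
  convex_polygon P /\
  exists C, [\/ hcircle C, horocycle C | equidistant_branch C] /\
    forall i, C (P i).

Definition side_length P (i : 'I_n) : R := hdist (P i) (P (ordS i)).

End Polygons.

End HyperbolicPlane.

(* Main.v *)
Require Import Defs.
From mathcomp Require Import all_boot all_order all_algebra.
From mathcomp Require Import all_classical all_reals all_analysis.
From mathcomp Require Import measurable_realfun.
From mathcomp Require Import ring lra.

Set Implicit Arguments.
Unset Strict Implicit.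
Unset Printing Implicit Defensive.

(** Write the vertices as complex numbers z_i = x_i + i y_i with y_i > 0,
    indices modulo 4, and let d_i be the distance from z_i to z_(i+1).

    In the coordinates (x, x^2 + y^2), those of the Klein model, geodesics are
    the straight lines, so hyperbolic convexity is ordinary convexity and the
    position of a point with respect to a side is the sign of a 3 by 3
    determinant ([kdet]). Integrating 1 / y^2 in y first turns the area into
    the integral of dx / y along the boundary; along the geodesic from p to q
    this integral is 2 atan ((x_q - x_p) / (y_p + y_q)), see [edge_area]. Hence
    S is, up to orientation, the sum of four such terms ([quad_region_area],
    [polygon_orientation]).

    The number (y_p + y_q) + i (x_q - x_p) is i (conj z_q - z_p), of modulus
    2 sqrt (y_p y_q) cosh (dist (p, q) / 2), while |z_q - z_p| is
    2 sqrt (y_p y_q) sinh (dist (p, q) / 2) by [sinh_hdist]. So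
    cos (S / 2) is the real part of the product of the numbers
    conj z_(i+1) - z_i, divided by 16 y_0 y_1 y_2 y_3 and by the product of the
    cosh (d_i / 2). That real part is equal, identically, to
      16 y_0 y_1 y_2 y_3 + 2 (sum of |z_(i+1) - z_i|^2 y_(i+2) y_(i+3)) + Re W
    where W = (z_1 - z_0) (z_3 - z_2) conj ((z_2 - z_1) (z_0 - z_3)).

    Circles, horocycles and branches of equidistant curves all have equations
    y = al (x^2 + y^2) + be x + de ([cyclic_linear]), so they are arcs of
    Euclidean circles or lines; for the successive vertices of a convex
    quadrilateral on such a curve, W is a negative real number, which is the
    equality case of the inequality of Ptolemy ([ptolemy_ccw]), and Re W is
    minus the product of the |z_(i+1) - z_i|. Dividing,
      cos (S / 2) * prod cosh (d_i / 2)
        = 1 + (sum of sinh (d_i / 2)^2) / 2 - prod sinh (d_i / 2),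
    and by [sinh_semiperimeter] the right-hand side is prod cosh (d_i / 2) - 2
    prod sinh ((s - d_i) / 2). The theorem is then the half-angle formula for S
    / 2. *)

Import Order.TTheory GRing.Theory Num.Theory.
Import numFieldNormedType.Exports.

Local Open Scope classical_set_scope.
Local Open Scope ring_scope.

(** * Hyperbolic functions *)

Section HyperbolicFunctions.
Variable R : realType.
Implicit Types a b c d s x y : R.

Lemma cosh_gt0 x : 0 < cosh x.
Proof. by rewrite /cosh divr_gt0// addr_gt0// expR_gt0. Qed.

Lemma cosh2E x : cosh x ^+ 2 = 1 + sinh x ^+ 2.
Proof. by rewrite /cosh /sinh expRN; field; rewrite gt_eqF ?expR_gt0. Qed.

Lemma sinh_ge0 x : 0 <= x -> 0 <= sinh x.
Proof.
by move=> x0; rewrite /sinh divr_ge0// subr_ge0 ler_expR; lra.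
Qed.

Lemma sinhM_coshB x y : sinh x * sinh y = (cosh (x + y) - cosh (x - y)) / 2.
Proof.
rewrite /cosh /sinh !opprD opprK !expRD !expRN.
by field; rewrite !gt_eqF ?expR_gt0.
Qed.

Lemma coshD x y : cosh (x + y) = cosh x * cosh y + sinh x * sinh y.
Proof.
by rewrite /cosh /sinh opprD !expRD !expRN; field; rewrite !gt_eqF ?expR_gt0.
Qed.

Lemma coshB x y : cosh (x - y) = cosh x * cosh y - sinh x * sinh y.
Proof.
rewrite /cosh /sinh opprD opprK !expRD !expRN; field.
by rewrite !gt_eqF ?expR_gt0.
Qed.

(** Pairing the factors, sinh ((s - a) / 2) sinh ((s - b) / 2) is half of cosh
    ((c + d) / 2) - cosh ((a - b) / 2), and similarly for the other two; the
    product of the two differences is a difference of squares in which cosh^2 =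
    1 + sinh^2 removes every cosh but their product. *)
Lemma sinh_semiperimeter a b c d s : s = (a + b + c + d) / 2 ->
  2 * (sinh ((s - a) / 2) * sinh ((s - b) / 2)
       * sinh ((s - c) / 2) * sinh ((s - d) / 2)) =
  cosh (a / 2) * cosh (b / 2) * cosh (c / 2) * cosh (d / 2)
  + sinh (a / 2) * sinh (b / 2) * sinh (c / 2) * sinh (d / 2)
  - 1 - (sinh (a / 2) ^+ 2 + sinh (b / 2) ^+ 2
         + sinh (c / 2) ^+ 2 + sinh (d / 2) ^+ 2) / 2.
Proof.
move=> ->.
set p := sinh (a / 2); set q := sinh (b / 2).
set r := sinh (c / 2); set t := sinh (d / 2).
set P := cosh (a / 2); set Q := cosh (b / 2).
set U := cosh (c / 2); set V := cosh (d / 2).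
have eab : sinh (((a + b + c + d) / 2 - a) / 2)
    * sinh (((a + b + c + d) / 2 - b) / 2) =
    (U * V + r * t - (P * Q - p * q)) / 2.
  rewrite sinhM_coshB.
  rewrite (_ : (_ - a) / 2 + _ = c / 2 + d / 2); last by field.
  rewrite (_ : (_ - a) / 2 - _ = b / 2 - a / 2); last by field.
  by rewrite coshD coshB -/p -/q -/r -/t -/P -/Q -/U -/V; field.
have ecd : sinh (((a + b + c + d) / 2 - c) / 2)
    * sinh (((a + b + c + d) / 2 - d) / 2) =
    (P * Q + p * q - (U * V - r * t)) / 2.
  rewrite sinhM_coshB.
  rewrite (_ : (_ - c) / 2 + _ = a / 2 + b / 2); last by field.
  rewrite (_ : (_ - c) / 2 - _ = d / 2 - c / 2); last by field.
  by rewrite coshD coshB -/p -/q -/r -/t -/P -/Q -/U -/V; field.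
rewrite -mulrA ecd eab.
have hP : P ^+ 2 = 1 + p ^+ 2 by exact: cosh2E.
have hQ : Q ^+ 2 = 1 + q ^+ 2 by exact: cosh2E.
have hU : U ^+ 2 = 1 + r ^+ 2 by exact: cosh2E.
have hV : V ^+ 2 = 1 + t ^+ 2 by exact: cosh2E.
suff -> : 2 * ((U * V + r * t - (P * Q - p * q)) / 2 *
     ((P * Q + p * q - (U * V - r * t)) / 2)) =
   ((p * q + r * t) ^+ 2 - P ^+ 2 * Q ^+ 2 - U ^+ 2 * V ^+ 2) / 2
   + P * Q * U * V.
  by rewrite hP hQ hU hV; field.
by field.
Qed.

End HyperbolicFunctions.

(** * Angles of the boundary integral *)

Section AngleSum.
Variable R : realType.
Implicit Types x y h C : R.

Lemma sin_atan x : sin (atan x) = x / Num.sqrt (1 + x ^+ 2).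
Proof.
have c0 : cos (atan x) != 0.
  by rewrite cos_atan invr_neq0// gt_eqF// sqrtr_gt0; nra.
by rewrite -cos_atan -{2}(atanK x) /tan divfK.
Qed.

(** The heights of the end points are written as squares h1^2 and h2^2, so that
    the modulus 2 h1 h2 C of (h1^2 + h2^2) + i (x2 - x1) is a polynomial; for
    C = cosh (dist / 2) the last hypothesis is the formula for the distance. *)
Lemma cos_sin_atan_edge x1 h1 x2 h2 C (t := (x2 - x1) / (h1 ^+ 2 + h2 ^+ 2)) :
  0 < h1 -> 0 < h2 -> 0 < C ->
  C ^+ 2 = 1 + ((x2 - x1) ^+ 2 + (h2 ^+ 2 - h1 ^+ 2) ^+ 2)
                 / (4 * h1 ^+ 2 * h2 ^+ 2) ->
  cos (atan t) = (h1 ^+ 2 + h2 ^+ 2) / (2 * h1 * h2 * C) /\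
  sin (atan t) = (x2 - x1) / (2 * h1 * h2 * C).
Proof.
move=> h1p h2p Cp hC.
have hp : 0 < h1 ^+ 2 + h2 ^+ 2 by nra.
have sE : Num.sqrt (1 + t ^+ 2) = 2 * h1 * h2 * C / (h1 ^+ 2 + h2 ^+ 2).
  rewrite -[RHS]ger0_norm; last by rewrite divr_ge0 ?mulr_ge0// ltW.
  rewrite -sqrtr_sqr; congr Num.sqrt.
  rewrite /t !exprMn hC exprVn; field.
  by rewrite !gt_eqF.
rewrite sin_atan cos_atan sE /t; split; field; rewrite ?gt_eqF//.
Qed.

End AngleSum.

(** * Klein coordinates and the theorem of Ptolemy *)

Section KleinModel.
Variable R : realType.
Implicit Types p q z : R * R.

Definition sqnorm z : R := z.1 ^+ 2 + z.2 ^+ 2.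

Definition sqdist p q : R := (q.1 - p.1) ^+ 2 + (q.2 - p.2) ^+ 2.

(** Twice the oriented area of the triangle p, q, z in the Klein coordinates
    (x, sqnorm); as a function of z it vanishes exactly on the geodesic through
    p and q when p and q are distinct. *)
Definition kdet p q z : R :=
  (q.1 - p.1) * (sqnorm z - sqnorm p) - (sqnorm q - sqnorm p) * (z.1 - p.1).

Definition ccw4 (p0 p1 p2 p3 : R * R) :=
  [/\ 0 < kdet p0 p1 p2, 0 < kdet p1 p2 p3,
      0 < kdet p2 p3 p0 & 0 < kdet p3 p0 p1].

Lemma kdetC p q z : kdet q p z = - kdet p q z.
Proof. by rewrite /kdet; ring. Qed.

Lemma kdet_rot p q z : kdet q z p = kdet p q z.
Proof. by rewrite /kdet; ring. Qed.

(** W is the real part of (z_1 - z_0) (z_3 - z_2) conj ((z_2 - z_1) (z_0 -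
    z_3)), by polarization of the identity (z_1 - z_0) (z_3 - z_2) - (z_2 -
    z_1) (z_0 - z_3) = (z_2 - z_0) (z_3 - z_1). Lifted to (1, x, y, x^2 + y^2),
    the four points are isotropic vectors for the bilinear form whose value on
    two lifts is the squared distance. Convexity gives a linear relation
    between the lifts, with signs + - + -; pairing it with each of them
    expresses all the squared distances through two of them. *)
Lemma ptolemy_ccw (p0 p1 p2 p3 : R * R) (al be de : R)
    (lin : forall p, p \in [:: p0; p1; p2; p3] ->
       p.2 = al * sqnorm p + be * p.1 + de)
    (W := (sqdist p0 p1 * sqdist p2 p3 + sqdist p1 p2 * sqdist p3 p0
           - sqdist p0 p2 * sqdist p1 p3) / 2) :
  ccw4 p0 p1 p2 p3 ->
  W <= 0 /\
  W ^+ 2 = sqdist p0 p1 * sqdist p1 p2 * sqdist p2 p3 * sqdist p3 p0.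
Proof.
move=> [l3 l0 l1 l2].
set L0 := kdet p1 p2 p3 in l0; set L1 := kdet p2 p3 p0 in l1.
set L2 := kdet p3 p0 p1 in l2; set L3 := kdet p0 p1 p2 in l3.
(* the barycentric relation between four points of the plane; it extends to the
   ordinates y, which are affine in the Klein coordinates *)
have e1 : L0 + L2 = L1 + L3 by rewrite /L0 /L1 /L2 /L3 /kdet; ring.
have ex : L0 * p0.1 + L2 * p2.1 = L1 * p1.1 + L3 * p3.1.
  by rewrite /L0 /L1 /L2 /L3 /kdet; ring.
have ev : L0 * sqnorm p0 + L2 * sqnorm p2 = L1 * sqnorm p1 + L3 * sqnorm p3.
  by rewrite /L0 /L1 /L2 /L3 /kdet; ring.
have ey : L0 * p0.2 + L2 * p2.2 = L1 * p1.2 + L3 * p3.2.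
  rewrite !lin ?inE ?eqxx ?orbT//.
  pose u := al * (L0 * sqnorm p0 + L2 * sqnorm p2)
            + be * (L0 * p0.1 + L2 * p2.1) + de * (L0 + L2).
  transitivity u; first by rewrite /u; ring.
  by rewrite /u e1 ex ev; ring.
clearbody L0 L1 L2 L3.
have pair q : L0 * sqdist p0 q + L2 * sqdist p2 q
            = L1 * sqdist p1 q + L3 * sqdist p3 q.
  have sE p : sqdist p q = sqnorm p + sqnorm q - 2 * p.1 * q.1 - 2 * p.2 * q.2.
    by rewrite /sqdist /sqnorm; ring.
  rewrite !sE.
  apply/eqP; rewrite -subr_eq0; apply/eqP.
  transitivity (
    (L0 * sqnorm p0 + L2 * sqnorm p2 - (L1 * sqnorm p1 + L3 * sqnorm p3))
    + sqnorm q * (L0 + L2 - (L1 + L3))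
    - 2 * q.1 * (L0 * p0.1 + L2 * p2.1 - (L1 * p1.1 + L3 * p3.1))
    - 2 * q.2 * (L0 * p0.2 + L2 * p2.2 - (L1 * p1.2 + L3 * p3.2))).
    by ring.
  by rewrite e1 ex ev ey; ring.
have dC p q : sqdist p q = sqdist q p by rewrite /sqdist; ring.
have d0 p : sqdist p p = 0 by rewrite /sqdist; ring.
have d_ge0 p q : 0 <= sqdist p q by rewrite /sqdist addr_ge0 ?sqr_ge0.
have r0 := pair p0; have r1 := pair p1; have r2 := pair p2; have r3 := pair p3.
rewrite /W.
rewrite !d0 !(dC p1 p0) !(dC p2 p0) !(dC p2 p1) !(dC p3 p1) !(dC p3 p2)
  in r0 r1 r2 r3.
rewrite (dC p0 p3) in r3.
set d01 := sqdist p0 p1 in r0 r1 r2 r3 *.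
set d12 := sqdist p1 p2 in r0 r1 r2 r3 *.
set d23 := sqdist p2 p3 in r0 r1 r2 r3 *.
set d30 := sqdist p3 p0 in r0 r1 r2 r3 *.
set d02 := sqdist p0 p2 in r0 r1 r2 r3 *.
set d13 := sqdist p1 p3 in r0 r1 r2 r3 *.
have d01p : 0 <= d01 by apply: d_ge0.
have d12p : 0 <= d12 by apply: d_ge0.
have L0n : L0 != 0 by rewrite gt_eqF.
have L1n : L1 != 0 by rewrite gt_eqF.
have L2n : L2 != 0 by rewrite gt_eqF.
have L3n : L3 != 0 by rewrite gt_eqF.
clearbody d01 d12 d23 d30 d02 d13.
have e02 : d02 = (L1 * d01 + L3 * d30) / L2.
  by apply: (mulfI L2n); rewrite mulrCA divff// mulr1; lra.
have e13 : d13 = (L0 * d01 + L2 * d12) / L3.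
  by apply: (mulfI L3n); rewrite mulrCA divff// mulr1; lra.
have e30 : d30 = L1 * L2 * d12 / (L0 * L3).
  apply: (mulfI (mulf_neq0 L0n L3n)); rewrite mulrCA divff ?mulf_neq0// mulr1.
  by nra.
have e23 : d23 = L0 * L1 * d01 / (L2 * L3).
  apply: (mulfI (mulf_neq0 L2n L3n)); rewrite mulrCA divff ?mulf_neq0// mulr1.
  by nra.
have -> : (d01 * d23 + d12 * d30 - d02 * d13) / 2 = - (d01 * d12 * L1 / L3).
  rewrite e02 e13 e23 e30; field.
  by rewrite L3n L2n L0n.
split; first by rewrite oppr_le0 divr_ge0 ?mulr_ge0// ltW.
by rewrite e23 e30; field; rewrite L3n L2n L0n.
Qed.

End KleinModel.

(** * From the boundary integral to the area formula *)

Section AreaFormula.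
Variable R : realType.
Implicit Types p q z : R * R.

(** The integral of dx / y along the geodesic from p to q: the difference of
    the polar angles of p and q around the Euclidean centre of that geodesic,
    written without the centre, and zero if the geodesic is vertical. *)
Definition edge_area p q : R := 2 * atan ((q.1 - p.1) / (p.2 + q.2)).

Lemma cos_sin_edge_area p q (a : R) : 0 < p.2 -> 0 < q.2 ->
  sinh (a / 2) ^+ 2 = sqdist p q / (4 * p.2 * q.2) ->
  let N := 2 * Num.sqrt p.2 * Num.sqrt q.2 * cosh (a / 2) in
  cos (edge_area p q / 2) = (p.2 + q.2) / N /\
  sin (edge_area p q / 2) = (q.1 - p.1) / N.
Proof.
move=> p0 q0 ha /=.
have -> : edge_area p q / 2 = atan ((q.1 - p.1) / (p.2 + q.2)).
  by rewrite /edge_area; field.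
have := @cos_sin_atan_edge _ p.1 (Num.sqrt p.2) q.1 (Num.sqrt q.2)
  (cosh (a / 2)).
rewrite !sqr_sqrtr ?ltW//; apply; rewrite ?sqrtr_gt0 ?cosh_gt0//.
by rewrite cosh2E ha /sqdist.
Qed.

(** The identity for the real part of the product of the conj z_(i+1) - z_i is
    contained in the computation of [cosS]: expanding the cosine of the sum of
    the four angles leaves a rational identity, valid for all real x_i and y_i
    > 0, in which concyclicity enters only through the value of the product of
    the sinh of the half-sides. *)
Lemma sin_sqr_sum_edge_area (p0 p1 p2 p3 : R * R) (al be de a b c d s S : R) :
  [/\ 0 < p0.2, 0 < p1.2, 0 < p2.2 & 0 < p3.2] ->
  (forall p, p \in [:: p0; p1; p2; p3] ->
     p.2 = al * sqnorm p + be * p.1 + de) ->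
  ccw4 p0 p1 p2 p3 ->
  [/\ 0 <= a, 0 <= b, 0 <= c & 0 <= d] ->
  sinh (a / 2) ^+ 2 = sqdist p0 p1 / (4 * p0.2 * p1.2) ->
  sinh (b / 2) ^+ 2 = sqdist p1 p2 / (4 * p1.2 * p2.2) ->
  sinh (c / 2) ^+ 2 = sqdist p2 p3 / (4 * p2.2 * p3.2) ->
  sinh (d / 2) ^+ 2 = sqdist p3 p0 / (4 * p3.2 * p0.2) ->
  s = (a + b + c + d) / 2 ->
  S = edge_area p0 p1 + edge_area p1 p2 + edge_area p2 p3 + edge_area p3 p0 ->
  sin (S / 4) ^+ 2 =
    (sinh ((s - a) / 2) * sinh ((s - b) / 2)
       * sinh ((s - c) / 2) * sinh ((s - d) / 2))
    / (cosh (a / 2) * cosh (b / 2) * cosh (c / 2) * cosh (d / 2)).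
Proof.
move=> [y0 y1 y2 y3] lin ccw [a0 b0 c0 d0] ha hb hc hd hs hS.
have [] := ptolemy_ccw lin ccw; set W := (X in X <= 0) => W0 W2.
have [ca sa] := cos_sin_edge_area y0 y1 ha.
have [cb sb] := cos_sin_edge_area y1 y2 hb.
have [cc sc] := cos_sin_edge_area y2 y3 hc.
have [cd sd] := cos_sin_edge_area y3 y0 hd.
have half (x : R) : 0 <= x -> 0 <= sinh (x / 2).
  by move=> x0; apply: sinh_ge0; rewrite divr_ge0.
have prodS : sinh (a / 2) * sinh (b / 2) * sinh (c / 2) * sinh (d / 2)
    = - W / (16 * p0.2 * p1.2 * p2.2 * p3.2).
  move: ha hb hc hd (half _ a0) (half _ b0) (half _ c0) (half _ d0).
  move: (sinh (a / 2)) (sinh (b / 2)) (sinh (c / 2)) (sinh (d / 2)).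
  move=> A B C D hA hB hC hD A0 B0 C0 D0.
  apply/eqP; rewrite -(eqrXn2 (n := 2))//; last 2 first.
  - by rewrite !mulr_ge0.
  - by rewrite divr_ge0 ?oppr_ge0// !mulr_ge0// ltW.
  apply/eqP; rewrite !exprMn exprVn sqrrN W2 hA hB hC hD; field.
  by rewrite !gt_eqF.
have cosS : cos (S / 2) = 1 - 2 * ((sinh ((s - a) / 2) * sinh ((s - b) / 2)
       * sinh ((s - c) / 2) * sinh ((s - d) / 2))
    / (cosh (a / 2) * cosh (b / 2) * cosh (c / 2) * cosh (d / 2))).
  rewrite [2 * (_ / _)]mulrA (sinh_semiperimeter hs) prodS ha hb hc hd.
  rewrite hS !mulrDl !(cosD, sinD) ca cb cc cd sa sb sc sd.
  have rt (y : R) : 0 < y -> exists2 h, 0 < h & y = h ^+ 2.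
    by move=> yp; exists (Num.sqrt y); rewrite ?sqrtr_gt0// sqr_sqrtr// ltW.
  have [h0 h0p e0] := rt _ y0; have [h1 h1p e1] := rt _ y1.
  have [h2 h2p e2] := rt _ y2; have [h3 h3p e3] := rt _ y3.
  rewrite /W /sqdist e0 e1 e2 e3 !sqrtr_sqr !gtr0_norm//.
  field.
  by rewrite !gt_eqF ?cosh_gt0// ?addr_gt0// ?exprn_gt0 ?mulr_gt0.
have e4 : sin (S / 4) = sin (S / 2 / 2) by congr sin; field.
have e2 : cos (S / 2) = cos (S / 2 / 2 *+ 2).
  by congr cos; rewrite mulr2n; field.
by move: cosS; rewrite e2 e4 cos_mulr2n mulr2n cos2sin2; lra.
Qed.

End AreaFormula.

(** * Calculus on the line *)

Section Calculus.
Variable R : realType.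
Implicit Types f g : R -> R.
Local Notation mu := (@lebesgue_measure R).

Lemma continuous_is_derive f (x a : R) :
  is_derive x 1 f a -> {for x, continuous f}.
Proof.
move=> df; apply/differentiable_continuous/derivable1_diffP.
exact: ex_derive.
Qed.

(** The derivation rules for functions given by an expression in a bound
    variable; the derivative of a formula is then read off by composing them. *)
Lemma is_derive_addf f g (x a b : R) : is_derive x 1 f a -> is_derive x 1 g b ->
  is_derive x 1 (fun t => f t + g t) (a + b).
Proof. by move=> ? ?; exact: is_deriveD. Qed.

Lemma is_derive_subf f g (x a b : R) : is_derive x 1 f a -> is_derive x 1 g b ->
  is_derive x 1 (fun t => f t - g t) (a - b).
Proof. by move=> ? ?; exact: is_deriveB. Qed.

Lemma is_derive_mulf f g (x a b : R) : is_derive x 1 f a -> is_derive x 1 g b ->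
  is_derive x 1 (fun t => f t * g t) (f x * b + g x * a).
Proof. by move=> ? ?; exact: is_deriveM. Qed.

Lemma is_derive_constf (c x : R) : is_derive x 1 (fun=> c) 0.
Proof. exact: is_derive_cst. Qed.

Lemma is_derive_mulcf (c : R) g (x b : R) : is_derive x 1 g b ->
  is_derive x 1 (fun t => c * g t) (c * b).
Proof.
move=> dg; have := is_derive_mulf (is_derive_constf c x) dg.
by rewrite mulr0 addr0.
Qed.

Lemma is_derive_divf f g (x a b : R) : g x != 0 ->
  is_derive x 1 f a -> is_derive x 1 g b ->
  is_derive x 1 (fun t => f t / g t) ((a * g x - f x * b) / g x ^+ 2).
Proof.
move=> g0 df dg; have dgV := is_deriveV g0 dg.
apply: is_derive_eq (is_derive_mulf df dgV) _.
by rewrite /GRing.scale/=; field.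
Qed.

Lemma is_derive_compf f g (x a b : R) : is_derive (g x) 1 f a ->
  is_derive x 1 g b -> is_derive x 1 (fun t => f (g t)) (a * b).
Proof. by move=> ? ?; exact: is_derive1_comp. Qed.

Lemma integrable_continuous_itv f (a b : R) :
  (forall x, a <= x <= b -> {for x, continuous f}) ->
  mu.-integrable `[a, b] (EFin \o f).
Proof.
move=> cf; apply: continuous_compact_integrable; first exact: segment_compact.
apply: continuous_in_subspaceT => x; rewrite inE/= in_itv/=; exact: cf.
Qed.

Lemma Rintegral_FTC f F (a b : R) : a <= b ->
  (forall x, a <= x <= b -> is_derive x 1 F (f x)) ->
  (forall x, a <= x <= b -> {for x, continuous f}) ->
  \int[mu]_(x in `[a, b]) f x = F b - F a.
Proof.
rewrite le_eqVlt => /predU1P[<- _ _|ab dF cf].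
  by rewrite set_itv1 Rintegral_set1 subrr.
rewrite /Rintegral (continuous_FTC2 (F := F))//.
- apply: continuous_in_subspaceT => x; rewrite inE/= in_itv/=; exact: cf.
- split.
  + move=> x; rewrite in_itv/= => /andP[ax xb].
    by apply: ex_derive; apply: dF; rewrite !ltW.
  + apply: cvg_at_right_filter; apply: continuous_is_derive.
    by apply: dF; rewrite lexx ltW.
  + apply: cvg_at_left_filter; apply: continuous_is_derive.
    by apply: dF; rewrite lexx ltW.
- move=> x; rewrite in_itv/= => /andP[ax xb].
  have := dF x; rewrite !ltW// => /(_ isT) [_ dv].
  by rewrite derive1E.
Qed.

Lemma inf_attained (E : set R) (m : R) : E m -> lbound E m -> inf E = m.
Proof.
move=> Em lbm; apply/eqP; rewrite eq_le; apply/andP; split.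
  by apply: ge_inf => //; exists m.
by apply: lb_le_inf => //; exists m.
Qed.

End Calculus.

(** * Geodesics and the distance *)

Section Distance.
Variable R : realType.
Implicit Types p q z : R * R.
Local Notation mu := (@lebesgue_measure R).

Section Geodesic.
Variables A B C D : R.
Hypothesis det1 : A * D - B * C = 1.

(** [geod] is the image of the vertical geodesic t |-> i e^t under the isometry
    z |-> (A z + B) / (C z + D).  Every geodesic has this form, which treats
    vertical lines and half-circles alike. *)
Definition geod_den (t : R) : R := C ^+ 2 * expR t ^+ 2 + D ^+ 2.
Definition geod_x (t : R) : R := (A * C * expR t ^+ 2 + B * D) / geod_den t.
Definition geod_y (t : R) : R := expR t / geod_den t.
Definition geod (t : R) : R * R := (geod_x t, geod_y t).

(* the squared moduli of the numerator and the denominator of the inverse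
   isometry z |-> (D z - B) / (A - C z) *)
Let num_sq z : R := (D * z.1 - B) ^+ 2 + (D * z.2) ^+ 2.
Let den_sq z : R := (A - C * z.1) ^+ 2 + (C * z.2) ^+ 2.

Let CD_neq0 : (C != 0) || (D != 0).
Proof.
rewrite -negb_and; apply/negP => /andP[/eqP C0 /eqP D0].
by move: det1; rewrite C0 D0 !mulr0 subrr => /eqP; rewrite eq_sym oner_eq0.
Qed.

Lemma geod_den_gt0 t : 0 < geod_den t.
Proof.
have E0 : 0 < expR t ^+ 2 by rewrite exprn_gt0 ?expR_gt0.
rewrite /geod_den; case/orP: CD_neq0 => n0.
  have C0 : 0 < C ^+ 2 by rewrite exprn_even_gt0.
  by rewrite ltr_wpDr ?sqr_ge0// mulr_gt0.
have D0 : 0 < D ^+ 2 by rewrite exprn_even_gt0.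
by rewrite ltr_wpDl// mulr_ge0 ?sqr_ge0.
Qed.

Lemma geod_y_gt0 t : 0 < geod_y t.
Proof. by rewrite divr_gt0 ?expR_gt0 ?geod_den_gt0. Qed.

Let is_derive_expR2 (t : R) :
  is_derive t 1 (fun t => expR t ^+ 2) (2 * expR t ^+ 2).
Proof.
apply: is_derive_eq (is_derive_mulf (is_derive_expR t) (is_derive_expR t)) _.
by ring.
Qed.

Let is_derive_den (t : R) : is_derive t 1 geod_den (2 * C ^+ 2 * expR t ^+ 2).
Proof.
apply: is_derive_eq (is_derive_addf (is_derive_mulcf _ (is_derive_expR2 t))
  (is_derive_constf _ t)) _.
by ring.
Qed.

Lemma is_derive_geod_x (t : R) :
  is_derive t 1 geod_x (2 * C * D * expR t ^+ 2 / geod_den t ^+ 2).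
Proof.
have d0 : geod_den t != 0 by rewrite gt_eqF// geod_den_gt0.
apply: is_derive_eq (is_derive_divf d0 (is_derive_addf
  (is_derive_mulcf (A * C) (is_derive_expR2 t))
  (is_derive_constf _ t)) (is_derive_den t)) _.
congr (_ / _); rewrite /geod_den; move: (expR t) => E.
have -> : 2 * C * D * E ^+ 2 = 2 * C * D * E ^+ 2 * (A * D - B * C).
  by rewrite det1 mulr1.
by ring.
Qed.

Lemma is_derive_geod_y (t : R) : is_derive t 1 geod_y
  (expR t * (D ^+ 2 - C ^+ 2 * expR t ^+ 2) / geod_den t ^+ 2).
Proof.
have d0 : geod_den t != 0 by rewrite gt_eqF// geod_den_gt0.
apply: is_derive_eq (is_derive_divf d0 (is_derive_expR t) (is_derive_den t)) _.
by congr (_ / _); rewrite /geod_den; ring.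
Qed.

Lemma geod_unit_speed (t : R) :
  (2 * C * D * expR t ^+ 2 / geod_den t ^+ 2) ^+ 2
  + (expR t * (D ^+ 2 - C ^+ 2 * expR t ^+ 2) / geod_den t ^+ 2) ^+ 2
  = geod_y t ^+ 2.
Proof.
have := geod_den_gt0 t; rewrite /geod_y /geod_den => d0.
by field; apply: lt0r_neq0; lra.
Qed.

Let num_sq_gt0 z : 0 < z.2 -> 0 < num_sq z.
Proof.
move=> z0; have [D0|D0] := eqVneq D 0.
  have B0 : B != 0.
    by apply/eqP => B0; move: det1; rewrite B0 D0; lra.
  by rewrite /num_sq D0 !mul0r sub0r sqrrN expr0n/= addr0 exprn_even_gt0.
by rewrite /num_sq ltr_wpDl ?sqr_ge0// exprn_even_gt0//= mulf_neq0// gt_eqF.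
Qed.

Let den_sq_gt0 z : 0 < z.2 -> 0 < den_sq z.
Proof.
move=> z0; have [C0|C0] := eqVneq C 0.
  have A0 : A != 0.
    by apply/eqP => A0; move: det1; rewrite A0 C0; lra.
  by rewrite /den_sq C0 !mul0r subr0 expr0n/= addr0 exprn_even_gt0.
by rewrite /den_sq ltr_wpDl ?sqr_ge0// exprn_even_gt0//= mulf_neq0// gt_eqF.
Qed.

(** The logarithm of the modulus of the image of z under the inverse isometry:
    the parameter of the orthogonal projection of z on the geodesic. *)
Definition geod_coord z : R := (ln (num_sq z) - ln (den_sq z)) / 2.

Lemma geod_coordK t : geod_coord (geod t) = t.
Proof.
have d0 := geod_den_gt0 t; have d_n0 : geod_den t != 0 by rewrite gt_eqF.
have nE : num_sq (geod t) = expR t ^+ 2 / geod_den t.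
  have -> : num_sq (geod t)
      = expR t ^+ 2 * (C ^+ 2 * expR t ^+ 2 * (A * D - B * C) ^+ 2 + D ^+ 2)
        / geod_den t ^+ 2.
    rewrite /num_sq /= /geod_x /geod_y; move: d0; rewrite /geod_den => d_gt0.
    by field; apply: lt0r_neq0; lra.
  by rewrite det1 expr1n mulr1 -/(geod_den t); field.
have dE : den_sq (geod t) = (geod_den t)^-1.
  have -> : den_sq (geod t)
      = (C ^+ 2 * expR t ^+ 2 + D ^+ 2 * (A * D - B * C) ^+ 2)
        / geod_den t ^+ 2.
    rewrite /den_sq /= /geod_x /geod_y; move: d0; rewrite /geod_den => d_gt0.
    by field; apply: lt0r_neq0; lra.
  by rewrite det1 expr1n mulr1 -/(geod_den t); field.
rewrite /geod_coord nE dE lnM ?posrE ?exprn_gt0 ?expR_gt0 ?invr_gt0//.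
by rewrite lnXn ?expR_gt0// expRK; field.
Qed.

Lemma is_derive_geod_coord (x y : R -> R) (t dx dy : R)
    (n := num_sq (x t, y t)) (m := den_sq (x t, y t)) :
  0 < y t -> is_derive t 1 x dx -> is_derive t 1 y dy ->
  is_derive t 1 (fun t => geod_coord (x t, y t))
    ((D * (D * x t - B) / n + C * (A - C * x t) / m) * dx
     + (D ^+ 2 * y t / n - C ^+ 2 * y t / m) * dy).
Proof.
move=> y0 hx hy.
have n0 : 0 < n by exact: num_sq_gt0.
have m0 : 0 < m by exact: den_sq_gt0.
have dsq f (a : R) : is_derive t 1 f a ->
    is_derive t 1 (fun t => f t ^+ 2) (2 * f t * a).
  by move=> df; apply: is_derive_eq (is_derive_mulf df df) _; ring.
have dn := is_derive_addf
  (dsq _ _ (is_derive_subf (is_derive_mulcf D hx) (is_derive_constf B t)))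
  (dsq _ _ (is_derive_mulcf D hy)).
have dm := is_derive_addf
  (dsq _ _ (is_derive_subf (is_derive_constf A t) (is_derive_mulcf C hx)))
  (dsq _ _ (is_derive_mulcf C hy)).
have dln := @is_derive_compf _ _ (fun t => num_sq (x t, y t)) _ _ _
  (is_derive1_ln n0) dn.
have dlm := @is_derive_compf _ _ (fun t => den_sq (x t, y t)) _ _ _
  (is_derive1_ln m0) dm.
apply: is_derive_eq (is_derive_mulf (is_derive_subf dln dlm)
  (is_derive_constf 2^-1 t)) _.
by field; rewrite !gt_eqF.
Qed.

(** [geod_coord] is 1-Lipschitz for the hyperbolic metric: the squared Euclidean
    norm of its gradient is 1 / (n m), and n m >= y^2 because y is the imaginary
    part of conj (A - C z) (D z - B) when A D - B C = 1. *)
Lemma geod_coord_lipschitz z (dx dy : R) (n := num_sq z) (m := den_sq z) :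
  0 < z.2 ->
  `|(D * (D * z.1 - B) / n + C * (A - C * z.1) / m) * dx
    + (D ^+ 2 * z.2 / n - C ^+ 2 * z.2 / m) * dy|
  <= Num.sqrt (dx ^+ 2 + dy ^+ 2) / z.2.
Proof.
move=> z0.
have n0 : 0 < n by exact: num_sq_gt0.
have m0 : 0 < m by exact: den_sq_gt0.
set al := (_ / n + _ / m); set be := (_ / n - _ / m).
have grad : al ^+ 2 + be ^+ 2 = (n * m)^-1.
  have -> : al ^+ 2 + be ^+ 2
      = ((A * D - B * C) ^+ 2 * (n * m)) / (n * m) ^+ 2.
    move: n0 m0; rewrite /al /be /n /m /num_sq /den_sq => n0 m0.
    by field; rewrite !gt_eqF.
  by rewrite det1; field; rewrite !gt_eqF.
have nm : z.2 ^+ 2 <= n * m.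
  have -> : n * m = (A * D - B * C) ^+ 2 * z.2 ^+ 2
      + ((D * z.1 - B) * (A - C * z.1) - C * D * z.2 ^+ 2) ^+ 2.
    by rewrite /n /m /num_sq /den_sq; ring.
  by rewrite det1 expr1n mul1r lerDl sqr_ge0.
rewrite ler_pdivlMr// -[X in _ * X](gtr0_norm z0) -normrM -sqrtr_sqr.
rewrite ler_sqrt; last first.
  by rewrite addr_ge0 ?sqr_ge0.
have CS : (al * dx + be * dy) ^+ 2 <= (al ^+ 2 + be ^+ 2) * (dx ^+ 2 + dy ^+ 2).
  rewrite -subr_ge0 (_ : _ - _ = (al * dy - be * dx) ^+ 2) ?sqr_ge0//.
  by ring.
rewrite exprMn (le_trans (ler_wpM2r (sqr_ge0 _) CS))//.
rewrite grad mulrAC ler_piMl ?addr_ge0 ?sqr_ge0//.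
by rewrite mulrC ler_pdivrMr ?mulr_gt0// mul1r.
Qed.

Lemma hlength_ge_geod_coord p q x y :
  hpath p q x y -> `|geod_coord q - geod_coord p| <= hlength x y.
Proof.
move=> [[dx cx] [dy cy] e0 e1 pos].
have hx (t : R) : is_derive t 1 x (derive1 x t).
  by rewrite derive1E; apply: DeriveDef => //; exact: dx.
have hy (t : R) : is_derive t 1 y (derive1 y t).
  by rewrite derive1E; apply: DeriveDef => //; exact: dy.
pose n t := num_sq (x t, y t); pose m t := den_sq (x t, y t).
pose g t := (D * (D * x t - B) / n t + C * (A - C * x t) / m t) * derive1 x t
     + (D ^+ 2 * y t / n t - C ^+ 2 * y t / m t) * derive1 y t.
have xc (t : R) : {for t, continuous x} by exact: continuous_is_derive (hx t).
have yc (t : R) : {for t, continuous y} by exact: continuous_is_derive (hy t).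
have sq_c (f : R -> R) (t : R) : {for t, continuous f} ->
    {for t, continuous (fun t => f t ^+ 2)}.
  by move=> cf; exact: (continuousM cf cf).
have k_c (c t : R) : {for t, continuous (fun=> c : R)} by exact: cst_continuous.
have nc (t : R) : {for t, continuous n}.
  apply: continuousD; apply: sq_c.
    apply: continuousB; last exact: k_c.
    by apply: continuousM; [exact: k_c|exact: xc].
  by apply: continuousM; [exact: k_c|exact: yc].
have mc (t : R) : {for t, continuous m}.
  apply: continuousD; apply: sq_c.
    apply: continuousB; first exact: k_c.
    by apply: continuousM; [exact: k_c|exact: xc].
  by apply: continuousM; [exact: k_c|exact: yc].
have gc (t : R) : 0 <= t <= 1 -> {for t, continuous g}.
  move=> /pos yt.
  have n0 : n t != 0 by rewrite gt_eqF// num_sq_gt0.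
  have m0 : m t != 0 by rewrite gt_eqF// den_sq_gt0.
  have nV := continuousV n0 (nc t); have mV := continuousV m0 (mc t).
  apply: continuousD; apply: continuousM; [|exact: cx| |exact: cy].
    apply: continuousD; apply: continuousM => //; apply: continuousM.
    - exact: k_c.
    - apply: continuousB; last exact: k_c.
      by apply: continuousM; [exact: k_c|exact: xc].
    - exact: k_c.
    - apply: continuousB; first exact: k_c.
      by apply: continuousM; [exact: k_c|exact: xc].
  apply: continuousB; apply: continuousM => //; apply: continuousM.
  - exact: k_c.
  - exact: yc.
  - exact: k_c.
  - exact: yc.
have sc (t : R) : 0 <= t <= 1 -> {for t, continuous
    (fun t => Num.sqrt (derive1 x t ^+ 2 + derive1 y t ^+ 2) / y t)}.
  move=> /pos yt; apply: continuousM.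
    apply: (@continuous_comp _ _ _
      (fun t => derive1 x t ^+ 2 + derive1 y t ^+ 2) Num.sqrt).
      by apply: continuousD; apply: sq_c; [exact: cx|exact: cy].
    exact: sqrt_continuous.
  by apply: continuousV; [rewrite gt_eqF|exact: yc].
have igc := integrable_continuous_itv gc.
have dg (t : R) : 0 <= t <= 1 ->
    is_derive t 1 (fun t => geod_coord (x t, y t)) (g t).
  by move=> /pos yt; exact: is_derive_geod_coord.
have <- : \int[mu]_(t in `[0, 1]) g t = geod_coord q - geod_coord p.
  by rewrite -e0 -e1 (Rintegral_FTC ler01 dg gc).
apply: le_trans (le_normr_Rintegral _ igc) _ => //.
apply: le_Rintegral => //.
- exact: (integrable_norm igc).
- exact: integrable_continuous_itv.
- move=> t; rewrite /= in_itv/= => /pos yt.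
  exact: (@geod_coord_lipschitz (x t, y t)).
Qed.

(** The lower bound integrates [geod_coord] along a path; it is attained by the
    geodesic itself, run through at constant speed. *)
Lemma hdist_geod (t0 t1 : R) : hdist (geod t0) (geod t1) = `|t1 - t0|.
Proof.
apply: inf_attained; last first.
  move=> L [x [y [hp ->]]].
  rewrite -{1}(geod_coordK t1) -{1}(geod_coordK t0).
  exact: hlength_ge_geod_coord.
pose T t := t0 + (t1 - t0) * t.
have dT (t : R) : is_derive t 1 T (t1 - t0).
  apply: is_derive_eq (is_derive_addf (is_derive_constf t0 t)
    (is_derive_mulcf (t1 - t0) (is_derive_id t 1))) _.
  by ring.
have dx t := is_derive_compf (is_derive_geod_x (T t)) (dT t).
have dy t := is_derive_compf (is_derive_geod_y (T t)) (dT t).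
exists (geod_x \o T), (geod_y \o T).
have dxE : derive1 (geod_x \o T) =
    fun t => 2 * C * D * expR (T t) ^+ 2 / geod_den (T t) ^+ 2 * (t1 - t0).
  by apply/funext => t; rewrite derive1E; case: (dx t).
have dyE : derive1 (geod_y \o T) =
    fun t => expR (T t) * (D ^+ 2 - C ^+ 2 * expR (T t) ^+ 2)
      / geod_den (T t) ^+ 2 * (t1 - t0).
  by apply/funext => t; rewrite derive1E; case: (dy t).
split; last first.
  rewrite /hlength dxE dyE.
  rewrite (@eq_Rintegral _ _ _ _ _ (fun=> `|t1 - t0|)).
    rewrite Rintegral_cst//= lebesgue_measure_itv/= lte_fin ltr01.
    by rewrite oppr0 adde0 mulr1.
  move=> t _; rewrite !(exprMn _ _ (t1 - t0)) -mulrDl geod_unit_speed -exprMn.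
  rewrite sqrtr_sqr normrM (gtr0_norm (geod_y_gt0 _)) mulrAC divff ?mul1r//.
  by rewrite gt_eqF// geod_y_gt0.
have cE (t : R) : {for t, continuous (fun t => expR (T t))}.
  exact: continuous_is_derive (is_derive_compf (is_derive_expR (T t)) (dT t)).
have sq_c (f : R -> R) (t : R) : {for t, continuous f} ->
    {for t, continuous (fun t => f t ^+ 2)}.
  by move=> cf; exact: (continuousM cf cf).
have k_c (c t : R) : {for t, continuous (fun=> c : R)} by exact: cst_continuous.
have cdV (t : R) : {for t, continuous (fun t => (geod_den (T t) ^+ 2)^-1)}.
  apply: continuousV; first by rewrite gt_eqF// exprn_gt0// geod_den_gt0.
  apply: sq_c.
  exact: continuous_is_derive (is_derive_compf (is_derive_den (T t)) (dT t)).
split.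
- split; first by move=> t; apply: ex_derive; exact: dx.
  rewrite dxE => t.
  exact: (continuousM (continuousM (continuousM (k_c _ t) (sq_c _ t (cE t)))
    (cdV t)) (k_c _ t)).
- split; first by move=> t; apply: ex_derive; exact: dy.
  rewrite dyE => t.
  exact: (continuousM (continuousM (continuousM (cE t) (continuousB (k_c _ t)
    (continuousM (k_c _ t) (sq_c _ t (cE t))))) (cdV t)) (k_c _ t)).
- by rewrite /= /T mulr0 addr0.
- by rewrite /= /T mulr1 addrC subrK.
- by move=> t _; exact: geod_y_gt0.
Qed.

Lemma sinh_hdist_geod (t0 t1 : R) :
  sinh (hdist (geod t0) (geod t1) / 2) ^+ 2 =
  sqdist (geod t0) (geod t1) / (4 * (geod t0).2 * (geod t1).2).
Proof.
rewrite hdist_geod.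
have -> : sinh (`|t1 - t0| / 2) ^+ 2 = sinh ((t1 - t0) / 2) ^+ 2.
  case: (ger0P (t1 - t0)) => // _.
  by rewrite /sinh mulNr opprK; field.
pose e0 := expR (t0 / 2); pose e1 := expR (t1 / 2).
have e0p : 0 < e0 by exact: expR_gt0.
have e1p : 0 < e1 by exact: expR_gt0.
have E0 : expR t0 = e0 ^+ 2 by rewrite /e0 expr2 -expRD; congr expR; field.
have E1 : expR t1 = e1 ^+ 2 by rewrite /e1 expr2 -expRD; congr expR; field.
have -> : sinh ((t1 - t0) / 2) = (e1 / e0 - e0 / e1) / 2.
  rewrite /sinh /e0 /e1 -!expRN -!expRD.
  by congr ((expR _ - expR _) / 2); field.
have d0 := geod_den_gt0 t0; have d1 := geod_den_gt0 t1.
rewrite /sqdist /= /geod_x /geod_y; move: d0 d1.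
rewrite /geod_den E0 E1 => d0 d1.
have -> :
    ((A * C * (e1 ^+ 2) ^+ 2 + B * D) / (C ^+ 2 * (e1 ^+ 2) ^+ 2 + D ^+ 2) -
     (A * C * (e0 ^+ 2) ^+ 2 + B * D) / (C ^+ 2 * (e0 ^+ 2) ^+ 2 + D ^+ 2))
  = C * D * (A * D - B * C) * (e1 ^+ 4 - e0 ^+ 4) /
    ((C ^+ 2 * (e1 ^+ 2) ^+ 2 + D ^+ 2) * (C ^+ 2 * (e0 ^+ 2) ^+ 2 + D ^+ 2)).
  by field; apply/andP; split; apply: lt0r_neq0; lra.
by rewrite det1; field; rewrite !gt_eqF//=; lra.
Qed.

End Geodesic.
End Distance.

Section CyclicCurves.
Variable R : realType.
Implicit Types p q z : R * R.

(** The half-circle of centre c and radius r has end points c - r and c + r,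
    the images of 0 and of the point at infinity; dividing by s = sqrt (2 r)
    makes the determinant 1. *)
Lemma geod_semicircle (c s : R) p (r := s ^+ 2 / 2) : 0 < s -> 0 < p.2 ->
  (p.1 - c) ^+ 2 + p.2 ^+ 2 = r ^+ 2 ->
  p = geod ((c + r) / s) ((c - r) / s) s^-1 s^-1 (ln ((p.1 - c + r) / p.2)).
Proof.
move=> s0 p0 pr.
have r0 : 0 < r by rewrite divr_gt0 ?exprn_gt0.
have u0 : 0 < p.1 - c + r.
  rewrite ltNge; apply/negP => u0; have : 0 < p.2 ^+ 2 by rewrite exprn_gt0.
  have : (p.1 - c) ^+ 2 >= r ^+ 2 by nra.
  by lra.
have s2 : s ^+ 2 = 2 * r by rewrite /r; field.
rewrite /geod /geod_x /geod_y /geod_den lnK ?posrE ?divr_gt0//.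
case: p p0 pr u0 => [x y] /= y0 pr u0.
have y2 : y ^+ 2 = (r - (x - c)) * (x - c + r) by move: pr; nra.
have r2 : 0 < r - (x - c).
  by have := exprn_gt0 2 y0; rewrite y2 pmulr_lgt0.
have yn : y != 0 by rewrite gt_eqF.
have sn : s != 0 by rewrite gt_eqF.
have den : s^-1 ^+ 2 * ((x - c + r) / y) ^+ 2 + s^-1 ^+ 2
    = (x - c + r) / y ^+ 2.
  rewrite exprVn s2 expr_div_n y2; field.
  by rewrite !gt_eqF.
rewrite den; congr (_, _).
  have -> : (c + r) / s * s^-1 * ((x - c + r) / y) ^+ 2 + (c - r) / s * s^-1
    = ((c + r) * ((x - c + r) / y) ^+ 2 + (c - r)) / s ^+ 2.
    by field; rewrite ?sn ?yn.
  rewrite s2 expr_div_n y2; field.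
  by rewrite !gt_eqF.
by field; rewrite yn gt_eqF.
Qed.

Lemma geod_through p q : 0 < p.2 -> 0 < q.2 ->
  exists A B C D t0 t1, [/\ A * D - B * C = 1,
    p = geod A B C D t0 & q = geod A B C D t1].
Proof.
move=> p0 q0; have [pq|pq] := eqVneq p.1 q.1.
  exists 1, p.1, 0, 1, (ln p.2), (ln q.2); split; first by ring.
    rewrite /geod /geod_x /geod_y /geod_den lnK//.
    case: p p0 {pq} => x y /= y0;
    by rewrite !(mul0r, mulr0, expr0n, expr1n, add0r, mulr1, divr1)/=.
  rewrite /geod /geod_x /geod_y /geod_den lnK// pq.
  case: q q0 {pq} => x y /= y0;
  by rewrite !(mul0r, mulr0, expr0n, expr1n, add0r, mulr1, divr1)/=.
have qp0 : q.1 - p.1 != 0 by rewrite subr_eq0 eq_sym.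
pose c := (sqnorm q - sqnorm p) / (2 * (q.1 - p.1)).
pose r := Num.sqrt ((p.1 - c) ^+ 2 + p.2 ^+ 2).
have rr : r ^+ 2 = (p.1 - c) ^+ 2 + p.2 ^+ 2.
  by rewrite sqr_sqrtr// addr_ge0 ?sqr_ge0.
have r0 : 0 < r by rewrite sqrtr_gt0 ltr_wpDl ?sqr_ge0 ?exprn_gt0.
have rrq : (q.1 - c) ^+ 2 + q.2 ^+ 2 = r ^+ 2.
  by rewrite rr /c /sqnorm; field.
pose s := Num.sqrt (2 * r).
have s0 : 0 < s by rewrite sqrtr_gt0 mulr_gt0.
have s2 : s ^+ 2 / 2 = r by rewrite sqr_sqrtr ?mulr_ge0 ?ltW//; field.
have gp := @geod_semicircle c s p s0 p0.
have gq := @geod_semicircle c s q s0 q0.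
rewrite s2 in gp gq.
exists ((c + r) / s), ((c - r) / s), s^-1, s^-1.
exists (ln ((p.1 - c + r) / p.2)), (ln ((q.1 - c + r) / q.2)).
split; [|exact: gp|exact: gq].
rewrite -{1 2}s2; field.
by rewrite gt_eqF.
Qed.

Lemma hdist_ge0 p q : 0 < p.2 -> 0 < q.2 -> 0 <= hdist p q.
Proof.
move=> /geod_through/[apply] -[A [B [C [D [t0 [t1 [det1 -> ->]]]]]]].
by rewrite hdist_geod.
Qed.

Lemma sinh_hdist p q : 0 < p.2 -> 0 < q.2 ->
  sinh (hdist p q / 2) ^+ 2 = sqdist p q / (4 * p.2 * q.2).
Proof.
move=> /geod_through/[apply] -[A [B [C [D [t0 [t1 [det1 -> ->]]]]]]].
by rewrite sinh_hdist_geod.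
Qed.

Lemma sinh_lt (x y : R) : x < y -> sinh x < sinh y.
Proof.
move=> xy; rewrite /sinh ltr_pM2r ?invr_gt0//.
by rewrite ltrD ?ltrN2 ?ltr_expR// ltrN2.
Qed.

Lemma le_hdist z p q : 0 < z.2 -> 0 < p.2 -> 0 < q.2 ->
  sqdist z p / p.2 <= sqdist z q / q.2 -> hdist z p <= hdist z q.
Proof.
move=> z0 p0 q0 pq; rewrite leNgt; apply/negP => lt.
have h0 := hdist_ge0 z0 q0.
have s0 : 0 <= sinh (hdist z q / 2) by apply: sinh_ge0; rewrite divr_ge0.
have : sinh (hdist z q / 2) ^+ 2 < sinh (hdist z p / 2) ^+ 2.
  rewrite ltr_pXn2r ?nnegrE ?sinh_ge0 ?sinh_lt ?divr_ge0 ?hdist_ge0//.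
  by rewrite ltr_pM2r ?invr_gt0.
apply/negP; rewrite -leNgt !sinh_hdist//.
have -> : sqdist z p / (4 * z.2 * p.2) = sqdist z p / p.2 / (4 * z.2).
  by field; rewrite !gt_eqF.
have -> : sqdist z q / (4 * z.2 * q.2) = sqdist z q / q.2 / (4 * z.2).
  by field; rewrite !gt_eqF.
by rewrite ler_pM2r// invr_gt0 mulr_gt0.
Qed.

Lemma hdist_line_attained z l w : 0 < z.2 -> on_hline l w ->
  (forall w', on_hline l w' -> sqdist z w / w.2 <= sqdist z w' / w'.2) ->
  hdist_line z l = hdist z w.
Proof.
move=> z0 lw min; apply: inf_attained; first by exists w.
move=> _ [w' lw' <-]; apply: le_hdist => //; last exact: min.
- by case: lw.
- by case: lw'.
Qed.

(** The normalization for which hside l z / (hline_scale l * z.2) is, up to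
    sign, the hyperbolic sine of the distance from z to l. *)
Definition hline_scale (l : hline R) : R :=
  match l with Vertical _ => 1 | Semicircle _ r => 2 * r%:num end.

Lemma hline_scale_gt0 l : 0 < hline_scale l.
Proof. by case: l => [c|c r]/=; rewrite ?mulr_gt0. Qed.

(** w is the foot of the perpendicular from z to l, and the second conclusion
    says that cosh^2 = 1 + sinh^2 for the distance from z to l. On a line,
    sqdist z w' / w'.2 is minimal at w; for the half-circle of radius r this is
    the inequality of Cauchy and Schwarz for (2 X r, N) and the vector from the
    centre to w'. *)
Lemma hline_foot l z : 0 < z.2 -> exists2 w, on_hline l w &
  (forall w', on_hline l w' -> sqdist z w / w.2 <= sqdist z w' / w'.2) /\
  (1 + sqdist z w / (2 * z.2 * w.2)) ^+ 2
    = 1 + (hside l z / (hline_scale l * z.2)) ^+ 2.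
Proof.
case: z => x y /= y0; case: l => [c|c rp]/=.
  pose m := Num.sqrt ((x - c) ^+ 2 + y ^+ 2).
  have m0 : 0 < m by rewrite sqrtr_gt0 ltr_wpDl ?sqr_ge0 ?exprn_gt0.
  have mm : m ^+ 2 = (x - c) ^+ 2 + y ^+ 2.
    by rewrite sqr_sqrtr// addr_ge0 ?sqr_ge0.
  have sE v : 0 < v -> sqdist (x, y) (c, v) / v = m ^+ 2 / v + v - 2 * y.
    by move=> v0; rewrite mm /sqdist/=; field; rewrite gt_eqF.
  exists (c, m); first by split => //=; rewrite subrr.
  split.
    move=> [u v] [/= v0 /eqP]; rewrite subr_eq0 => /eqP ->.
    rewrite !sE// lerD2r -subr_ge0.
    have -> : m ^+ 2 / v + v - (m ^+ 2 / m + m) = (m - v) ^+ 2 / v.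
      by field; rewrite !gt_eqF.
    by rewrite divr_ge0 ?sqr_ge0// ltW.
  rewrite mul1r /sqdist/=.
  have -> : 1 + ((c - x) ^+ 2 + (m - y) ^+ 2) / (2 * y * m) = m / y.
    have -> : (c - x) ^+ 2 + (m - y) ^+ 2 = 2 * m ^+ 2 - 2 * m * y.
      by move: mm; nra.
    by field; rewrite !gt_eqF.
  by rewrite !expr_div_n mm; field; rewrite gt_eqF.
set r := rp%:num; have r0 : 0 < r by rewrite /r.
pose X := x - c; pose A := X ^+ 2 + y ^+ 2 + r ^+ 2.
have A0 : 0 < A.
  by rewrite /A ltr_wpDr ?sqr_ge0// ltr_wpDl ?sqr_ge0// exprn_gt0.
pose N := Num.sqrt ((X ^+ 2 + y ^+ 2 - r ^+ 2) ^+ 2 + 4 * r ^+ 2 * y ^+ 2).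
have N0 : 0 < N.
  have r2 : 0 < r ^+ 2 by rewrite exprn_gt0.
  have y2 : 0 < y ^+ 2 by rewrite exprn_gt0.
  by rewrite sqrtr_gt0 ltr_wpDl ?sqr_ge0// mulr_gt0// mulr_gt0.
have NN : N ^+ 2 = (X ^+ 2 + y ^+ 2 - r ^+ 2) ^+ 2 + 4 * r ^+ 2 * y ^+ 2.
  rewrite sqr_sqrtr// addr_ge0 ?sqr_ge0// mulr_ge0 ?sqr_ge0//.
  by rewrite mulr_ge0 ?sqr_ge0.
have NA : N ^+ 2 = A ^+ 2 - 4 * X ^+ 2 * r ^+ 2 by rewrite NN /A; ring.
have sE u v : 0 < v -> (u - c) ^+ 2 + v ^+ 2 - r ^+ 2 = 0 ->
    sqdist (x, y) (u, v) / v = (A - 2 * X * (u - c)) / v - 2 * y.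
  move=> v0 uv; rewrite /sqdist/=.
  have -> : (u - x) ^+ 2 + (v - y) ^+ 2
     = A - 2 * X * (u - c) - 2 * y * v + ((u - c) ^+ 2 + v ^+ 2 - r ^+ 2).
    by rewrite /A /X; ring.
  by rewrite uv; field; rewrite gt_eqF.
pose u0 := c + 2 * X * r ^+ 2 / A; pose v0 := N * r / A.
have v0p : 0 < v0 by rewrite !mulr_gt0// invr_gt0.
have u0v0 : (u0 - c) ^+ 2 + v0 ^+ 2 - r ^+ 2 = 0.
  have -> : (u0 - c) ^+ 2 + v0 ^+ 2 - r ^+ 2
      = r ^+ 2 * (N ^+ 2 - (A ^+ 2 - 4 * X ^+ 2 * r ^+ 2)) / A ^+ 2.
    by rewrite /u0 /v0; field; rewrite gt_eqF.
  by rewrite NA subrr mulr0 mul0r.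
have min0 : (A - 2 * X * (u0 - c)) / v0 = N / r.
  have -> : (A - 2 * X * (u0 - c)) / v0
      = (A ^+ 2 - 4 * X ^+ 2 * r ^+ 2) / (N * r).
    by rewrite /u0 /v0; field; rewrite !gt_eqF.
  by rewrite -NA; field; rewrite !gt_eqF.
exists (u0, v0); first by split.
split.
  move=> [u v] [/= vp]; rewrite -/r => uv; rewrite !sE// min0 lerD2r.
  rewrite ler_pdivlMr// mulrAC ler_pdivrMr//.
  suff : N * v + 2 * X * r * (u - c) <= A * r by lra.
  have e : (N * v + 2 * X * r * (u - c)) ^+ 2 <= (A * r) ^+ 2.
    have -> : (A * r) ^+ 2 = (A ^+ 2) * (r ^+ 2) by rewrite exprMn.
    have -> : A ^+ 2 = N ^+ 2 + 4 * X ^+ 2 * r ^+ 2 by rewrite NA; ring.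
    have -> : (N ^+ 2 + 4 * X ^+ 2 * r ^+ 2) * r ^+ 2
       = (N ^+ 2 + 4 * X ^+ 2 * r ^+ 2) * ((u - c) ^+ 2 + v ^+ 2)
         - (N ^+ 2 + 4 * X ^+ 2 * r ^+ 2) * ((u - c) ^+ 2 + v ^+ 2 - r ^+ 2).
      by ring.
    rewrite uv mulr0 subr0 -subr_ge0.
    rewrite (_ : _ - _ = (N * (u - c) - 2 * X * r * v) ^+ 2) ?sqr_ge0//.
    by ring.
  have Ar0 : 0 <= A * r by rewrite mulr_ge0// ltW.
  rewrite leNgt; apply/negP => lt; move: e; rewrite leNgt => /negP; apply.
  by rewrite ltr_pXn2r ?nnegrE// (le_trans Ar0)// ltW.
have -> : 1 + sqdist (x, y) (u0, v0) / (2 * y * v0)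
    = 1 + (sqdist (x, y) (u0, v0) / v0) / (2 * y) by field; rewrite !gt_eqF.
rewrite sE// min0.
have -> : 1 + (N / r - 2 * y) / (2 * y) = N / (2 * r * y).
  by field; rewrite !gt_eqF.
rewrite !expr_div_n NN -/X; field.
by rewrite !gt_eqF.
Qed.

End CyclicCurves.

(** * Circles, horocycles and equidistant curves *)

Section CyclicLinear.
Variable R : realType.
Implicit Types p q z : R * R.

Lemma hside_affine (l : hline R) : exists k b e, forall z,
  hside l z = k * sqnorm z + b * z.1 + e.
Proof.
case: l => [c|c r] /=.
  by exists 0, 1, (- c) => z; ring.
exists 1, (- 2 * c), (c ^+ 2 - r%:num ^+ 2) => z; rewrite /sqnorm; ring.
Qed.

(** Each of the three conditions is a linear equation between 1, x, x^2 + y^2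
    and y, in which the coefficient of y does not vanish: for a circle of
    centre ctr because sqdist ctr p / p.2 is constant, for an equidistant curve
    because hside l p / p.2 is. *)
Lemma cyclic_linear (C : set (R * R)) :
  [\/ hcircle C, horocycle C | equidistant_branch C] ->
  exists al be de, forall p, uhp p -> C p ->
    p.2 = al * sqnorm p + be * p.1 + de.
Proof.
case.
- move=> [ctr [r [c0 r0 ->]]].
  pose k := sinh (r / 2) ^+ 2; pose m := 2 * ctr.2 * (1 + 2 * k).
  have c20 : 0 < ctr.2 by [].
  have m0 : 0 < m.
    by rewrite mulr_gt0 ?mulr_gt0// ltr_pwDl// mulr_ge0 ?sqr_ge0.
  exists m^-1, (- 2 * ctr.1 / m), (sqnorm ctr / m) => p _ [p0 op].
  have := sinh_hdist c0 p0; rewrite op -/k => kE.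
  have dE : 4 * ctr.2 * p.2 * k = sqdist ctr p.
    by rewrite kE; field; rewrite !gt_eqF.
  apply: (mulfI (lt0r_neq0 m0)).
  have -> : m * (m^-1 * sqnorm p + - 2 * ctr.1 / m * p.1 + sqnorm ctr / m)
     = sqnorm p - 2 * ctr.1 * p.1 + sqnorm ctr.
    by field; rewrite gt_eqF.
  have -> : m * p.2 = 2 * ctr.2 * p.2 + 4 * ctr.2 * p.2 * k by rewrite /m; ring.
  by rewrite dE /sqdist /sqnorm; ring.
- case=> [ [k k0 ->]|[c [r [r0 ->]]] ].
    by exists 0, 0, k => p _ /= ->; ring.
  exists (2 * r)^-1, (- c / r), (c ^+ 2 / (2 * r)) => p _ /= [_ pr].
  have rn : r != 0 by rewrite gt_eqF.
  have r2n : 2 * r != 0 by rewrite mulf_neq0// pnatr_eq0.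
  apply: (mulfI r2n).
  have -> : 2 * r * ((2 * r)^-1 * sqnorm p + - c / r * p.1 + c ^+ 2 / (2 * r))
    = sqnorm p - 2 * c * p.1 + c ^+ 2 by field.
  by rewrite /sqnorm; lra.
- move=> [l [h [b [h0 ->]]]].
  have [k [b' [e hE]]] := hside_affine l.
  pose sg : R := (-1) ^+ b.
  have sg2 : sg ^+ 2 = 1 by rewrite /sg -exprM mulnC exprM sqrrN !expr1n.
  pose rho := hline_scale l; have rho0 : 0 < rho := hline_scale_gt0 l.
  pose ka := sinh h.
  have ka0 : 0 < ka.
    by have := sinh_lt h0; rewrite /ka {1}/sinh oppr0 subrr mul0r.
  exists (sg * k / (ka * rho)), (sg * b' / (ka * rho)), (sg * e / (ka * rho)).
  move=> p p0 [_ dl sp].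
  have [w lw [wmin wE]] := hline_foot l p0.
  have w0 : 0 < w.2 by case: lw.
  have := sinh_hdist p0 w0; rewrite -(hdist_line_attained p0 lw wmin) dl => sE.
  have chE : cosh h = 1 + 2 * sinh (h / 2) ^+ 2.
    have -> : cosh h = cosh (h / 2 + h / 2) by congr cosh; field.
    by rewrite coshD -!expr2 cosh2E; ring.
  have e1 : (hside l p / (rho * p.2)) ^+ 2 = ka ^+ 2.
    apply: (addrI 1); rewrite -wE -cosh2E chE sE; congr (_ ^+ 2).
    by field; rewrite !gt_eqF.
  have e2 : sg * hside l p / (rho * p.2) = ka.
    apply/eqP; rewrite -(eqrXn2 (n := 2)) ?ltW//; last first.
      by rewrite divr_gt0// mulr_gt0.
    by rewrite -mulrA exprMn sg2 mul1r e1.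
  have e3 : sg * hside l p = ka * (rho * p.2).
    by rewrite -e2 divfK// mulf_neq0// gt_eqF.
  have -> : sg * k / (ka * rho) * sqnorm p + sg * b' / (ka * rho) * p.1
     + sg * e / (ka * rho) = sg * hside l p / (ka * rho).
    by rewrite hE; field; rewrite !gt_eqF.
  by rewrite e3; field; rewrite !gt_eqF.
Qed.

(** Both sides are affine in the Klein coordinates and vanish at p and at q. *)
Lemma kdet_hside (l : hline R) p q : on_hline l p -> on_hline l q -> p <> q ->
  exists2 k, k != 0 & forall z, kdet p q z = k * hside l z.
Proof.
case: p q => [px py] [qx qy] [/= p0 lp] [/= q0 lq] npq.
case: l lp lq => [c|c r] /= lp lq.
  have pc : px = c by lra.
  have qc : qx = c by lra.
  exists (py ^+ 2 - qy ^+ 2).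
    apply/eqP => /eqP; rewrite subr_eq0 eqrXn2 ?ltW// => /eqP pq.
    by apply: npq; rewrite pc qc pq.
  by move=> z; rewrite /kdet /sqnorm/= pc qc; ring.
exists (qx - px).
  apply/eqP => pq; have {}pq : qx = px by lra.
  have : py ^+ 2 == qy ^+ 2 by apply/eqP; move: lp lq; rewrite pq; lra.
  rewrite eqrXn2 ?ltW// => /eqP pyE.
  by apply: npq; rewrite pq pyE.
move=> z; rewrite /kdet /sqnorm /=.
have p2 : py ^+ 2 = r%:num ^+ 2 - (px - c) ^+ 2 by lra.
have q2 : qy ^+ 2 = r%:num ^+ 2 - (qx - c) ^+ 2 by lra.
by rewrite p2 q2; ring.
Qed.

End CyclicLinear.

(** * Vertical slices of a convex quadrilateral *)

Section Slices.
Variable R : realType.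
Implicit Types p q z : R * R.

(** In Klein coordinates, the second coordinate at the abscissa x of the line
    through p and q; subtracting x^2 gives the square of the height of the
    geodesic. *)
Definition chord p q (x : R) : R :=
  sqnorm p + (sqnorm q - sqnorm p) * (x - p.1) / (q.1 - p.1).

Definition height p q (x : R) : R := Num.sqrt (chord p q x - x ^+ 2).

(** The contribution of the side from p to q to the integral of 1 / y^2 over the
    slice of abscissa x: 1 / y at the lower end of the slice, where the boundary
    of a counterclockwise polygon goes to the right, minus 1 / y at the upper
    end. *)
Definition edge_density p q (x : R) : R :=
  ((p.1 < x)%R%:R - (q.1 < x)%R%:R) / height p q x.

Lemma chordC p q x : p.1 != q.1 -> chord p q x = chord q p x.
Proof.
move=> pq; have n1 : q.1 - p.1 != 0 by rewrite subr_eq0 eq_sym.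
have n2 : p.1 - q.1 != 0 by rewrite subr_eq0.
by rewrite /chord; field; rewrite n1 n2.
Qed.

Lemma chord_sub p q x : p.1 != q.1 -> chord p q x - x ^+ 2 =
  (q.1 - x) / (q.1 - p.1) * p.2 ^+ 2 + (x - p.1) / (q.1 - p.1) * q.2 ^+ 2
  + (x - p.1) * (q.1 - x).
Proof.
move=> pq; have n1 : q.1 - p.1 != 0 by rewrite subr_eq0 eq_sym.
by rewrite /chord /sqnorm; field.
Qed.

Lemma chord_sub_gt0 p q x : 0 < p.2 -> 0 < q.2 -> p.1 < q.1 ->
  p.1 <= x <= q.1 ->
  0 < chord p q x - x ^+ 2.
Proof.
move=> p0 q0 pq /andP[px xq]; rewrite chord_sub ?lt_eqF//.
have d0 : 0 < q.1 - p.1 by rewrite subr_gt0.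
have a0 : 0 <= (q.1 - x) / (q.1 - p.1) by rewrite divr_ge0 ?subr_ge0// ltW.
have b0 : 0 <= (x - p.1) / (q.1 - p.1) by rewrite divr_ge0 ?subr_ge0// ltW.
have ab : (q.1 - x) / (q.1 - p.1) + (x - p.1) / (q.1 - p.1) = 1.
  by field; rewrite gt_eqF.
have p2 : 0 < p.2 ^+ 2 by rewrite exprn_gt0.
have q2 : 0 < q.2 ^+ 2 by rewrite exprn_gt0.
rewrite ltr_wpDr ?mulr_ge0 ?subr_ge0//.
move: a0 b0 ab; set a := _ / _; set b := _ / _ => a0 b0 ab.
have [a1|a1] := lerP a 2^-1.
  by apply: ltr_wpDl; [exact: mulr_ge0 a0 (ltW p2)|apply: mulr_gt0 => //; lra].
by apply: ltr_wpDr; [exact: mulr_ge0 b0 (ltW q2)|apply: mulr_gt0 => //; lra].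
Qed.

Lemma kdet_chord p q x y : p.1 != q.1 ->
  kdet p q (x, y) = (q.1 - p.1) * (y ^+ 2 - (chord p q x - x ^+ 2)).
Proof.
move=> pq; have n1 : q.1 - p.1 != 0 by rewrite subr_eq0 eq_sym.
by rewrite /kdet /chord /sqnorm/=; field.
Qed.

Lemma kdet_lower p q x y : 0 < p.2 -> 0 < q.2 -> p.1 < x -> x < q.1 -> 0 < y ->
  (0 <= kdet p q (x, y)) = (height p q x <= y).
Proof.
move=> p0 q0 px xq y0; have pq := lt_trans px xq.
have c0 : 0 < chord p q x - x ^+ 2.
  by apply: chord_sub_gt0 => //; rewrite !ltW.
rewrite kdet_chord ?lt_eqF// pmulr_rge0 ?subr_gt0// subr_ge0.
by rewrite /height -[in RHS](gtr0_norm y0) -sqrtr_sqr ler_sqrt// sqr_ge0.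
Qed.

Lemma kdet_upper p q x y : 0 < p.2 -> 0 < q.2 -> q.1 < x -> x < p.1 -> 0 < y ->
  (0 <= kdet p q (x, y)) = (y <= height p q x).
Proof.
move=> p0 q0 qx xp y0; have qp := lt_trans qx xp.
have c0 : 0 < chord p q x - x ^+ 2.
  by rewrite chordC ?gt_eqF//; apply: chord_sub_gt0 => //; rewrite !ltW.
rewrite kdet_chord ?gt_eqF// nmulr_rge0 ?subr_lt0// subr_le0.
by rewrite /height -[in RHS](gtr0_norm y0) -sqrtr_sqr ler_sqrt// ltW.
Qed.

Lemma height_gt0 p q x : 0 < p.2 -> 0 < q.2 -> p.1 < q.1 -> p.1 <= x <= q.1 ->
  0 < height p q x.
Proof. by move=> *; rewrite sqrtr_gt0 chord_sub_gt0. Qed.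

Lemma heightC p q x : p.1 != q.1 -> height p q x = height q p x.
Proof. by move=> pq; rewrite /height chordC. Qed.

Lemma kdet_height p q r s x : r.1 != s.1 -> 0 <= chord r s x - x ^+ 2 ->
  kdet p q (x, height r s x) * (s.1 - r.1)
  = (s.1 - x) * kdet p q r + (x - r.1) * kdet p q s.
Proof.
move=> rs c0; have n1 : s.1 - r.1 != 0 by rewrite subr_eq0 eq_sym.
rewrite /kdet {1}/sqnorm/= sqr_sqrtr// /chord; by field.
Qed.

Definition in_quad p0 p1 p2 p3 z : Prop :=
  [/\ 0 <= kdet p0 p1 z, 0 <= kdet p1 p2 z,
      0 <= kdet p2 p3 z & 0 <= kdet p3 p0 z].

Definition quad_density p0 p1 p2 p3 (x : R) : R :=
  edge_density p0 p1 x + edge_density p1 p2 x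
  + edge_density p2 p3 x + edge_density p3 p0 x.

Definition slice_spec p0 p1 p2 p3 x : Prop :=
  ((forall y, 0 < y -> ~ in_quad p0 p1 p2 p3 (x, y)) /\
     quad_density p0 p1 p2 p3 x = 0)
  \/ exists lo hi, [/\ 0 < lo, lo <= hi,
       forall y, 0 < y -> in_quad p0 p1 p2 p3 (x, y) <-> lo <= y <= hi &
       quad_density p0 p1 p2 p3 x = lo^-1 - hi^-1].

Lemma ccw4_rot p0 p1 p2 p3 : ccw4 p0 p1 p2 p3 -> ccw4 p1 p2 p3 p0.
Proof. by case. Qed.

Lemma in_quad_rot p0 p1 p2 p3 z :
  in_quad p1 p2 p3 p0 z <-> in_quad p0 p1 p2 p3 z.
Proof. by split; case. Qed.

Lemma slice_spec_rot p0 p1 p2 p3 x :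
  slice_spec p1 p2 p3 p0 x -> slice_spec p0 p1 p2 p3 x.
Proof.
have qE : quad_density p0 p1 p2 p3 x = quad_density p1 p2 p3 p0 x.
  by rewrite /quad_density; ring.
have inE y := in_quad_rot p0 p1 p2 p3 (x, y).
move=> [[h e]|[lo [hi [lo0 lohi h e]]]]; [left|right].
  by rewrite qE; split => // y y0 hy; apply: (h y y0); apply/inE.
exists lo, hi; split; rewrite ?qE// => y y0.
by rewrite -h//; split => hy; apply/inE.
Qed.

(** When the slice separates the vertex p0 from the others, the two sides
    through p0 decide. The sign s is 1 if p0 is on the left of the slice and
    -1 if it is on the right; the identities express the determinants in the
    barycentric coordinates of (x, y) in the triangle p0, p1, p3. *)
Lemma in_quad_corner p0 p1 p2 p3 x y (s : R) : ccw4 p0 p1 p2 p3 ->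
  0 < s * (x - p0.1) -> 0 < s * (p1.1 - x) -> 0 < s * (p3.1 - x) ->
  0 <= kdet p0 p1 (x, y) -> 0 <= kdet p3 p0 (x, y) ->
  in_quad p0 p1 p2 p3 (x, y).
Proof.
move=> [D012 D123 D230 D301] h0 h1 h3 k01 k30.
have k13 : 0 <= kdet p1 p3 (x, y).
  rewrite -(pmulr_lge0 _ h0).
  have -> : kdet p1 p3 (x, y) * (s * (x - p0.1)) =
    kdet p0 p1 (x, y) * (s * (p3.1 - x)) + kdet p3 p0 (x, y) * (s * (p1.1 - x)).
    by rewrite /kdet /sqnorm/=; ring.
  by rewrite addr_ge0// mulr_ge0// ltW.
split=> //.
  rewrite -(pmulr_lge0 _ D301).
  have -> : kdet p1 p2 (x, y) * kdet p3 p0 p1 =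
    kdet p0 p1 (x, y) * kdet p1 p2 p3 + kdet p1 p3 (x, y) * kdet p0 p1 p2.
    by rewrite /kdet /sqnorm/=; ring.
  by rewrite addr_ge0// mulr_ge0// ltW.
rewrite -(pmulr_lge0 _ D301).
have -> : kdet p2 p3 (x, y) * kdet p3 p0 p1 =
  kdet p1 p3 (x, y) * kdet p2 p3 p0 + kdet p3 p0 (x, y) * kdet p1 p2 p3.
  by rewrite /kdet /sqnorm/=; ring.
by rewrite addr_ge0// mulr_ge0// ltW.
Qed.

(** Here the slice separates p0 and p1 from p2. The barycentric
    coordinates of (x, y) in the triangle p0, p1, p2 satisfy one linear
    relation because the abscissa is x, and another gives kdet p3 p0 (x, y);
    eliminating kdet p2 p0 (x, y) between the two leaves kdet p0 p1 (x, y) with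
    a positive multiplier. *)
Lemma in_quad_opposite_half p0 p1 p2 p3 x y (s : R) : ccw4 p0 p1 p2 p3 ->
  0 < s * (x - p0.1) -> 0 < s * (x - p1.1) -> 0 < s * (p2.1 - x) ->
  0 <= kdet p1 p2 (x, y) -> 0 <= kdet p3 p0 (x, y) -> 0 <= kdet p0 p1 (x, y).
Proof.
move=> [D012 D123 D230 D301] h0 h1 h2 k12 k30.
have c0 : 0 < kdet p3 p0 p1 * (s * (p2.1 - x))
              + kdet p2 p3 p0 * (s * (x - p1.1)).
  by rewrite addr_gt0// mulr_gt0.
rewrite -(pmulr_lge0 _ c0).
have -> : kdet p0 p1 (x, y) *
    (kdet p3 p0 p1 * (s * (p2.1 - x)) + kdet p2 p3 p0 * (s * (x - p1.1)))
  = kdet p3 p0 p1 * kdet p1 p2 (x, y) * (s * (x - p0.1))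
    + kdet p0 p1 p2 * kdet p3 p0 (x, y) * (s * (x - p1.1)).
  by rewrite /kdet /sqnorm/=; ring.
by apply: addr_ge0; apply: mulr_ge0; rewrite ?(ltW h0) ?(ltW h1)//;
  apply: mulr_ge0 => //; exact: ltW.
Qed.

Lemma in_quad_opposite p0 p1 p2 p3 x y (s : R) : ccw4 p0 p1 p2 p3 ->
  0 < s * (x - p0.1) -> 0 < s * (x - p1.1) ->
  0 < s * (p2.1 - x) -> 0 < s * (p3.1 - x) ->
  0 <= kdet p1 p2 (x, y) -> 0 <= kdet p3 p0 (x, y) ->
  in_quad p0 p1 p2 p3 (x, y).
Proof.
move=> ccw h0 h1 h2 h3 k12 k30; split=> //.
  exact: (@in_quad_opposite_half p0 p1 p2 p3 x y s).
apply: (@in_quad_opposite_half p2 p3 p0 p1 x y (- s)) => //.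
- by case: ccw => *; split.
- by rewrite mulNr -mulrN opprB.
- by rewrite mulNr -mulrN opprB.
- by rewrite mulNr -mulrN opprB.
Qed.

(** The diagonals of a convex quadrilateral cross, so a line cannot have p0 and
    p2 on one side and p1 and p3 on the other. *)
Lemma not_alternating p0 p1 p2 p3 x (s : R) : ccw4 p0 p1 p2 p3 ->
  0 < s * (x - p0.1) -> 0 < s * (p1.1 - x) ->
  0 < s * (x - p2.1) -> 0 < s * (p3.1 - x) -> False.
Proof.
move=> [D012 D123 D230 D301] h0 h1 h2 h3.
have : 0 < kdet p1 p2 p3 * (s * (x - p0.1)) + kdet p3 p0 p1 * (s * (x - p2.1))
   + kdet p2 p3 p0 * (s * (p1.1 - x)) + kdet p0 p1 p2 * (s * (p3.1 - x)).
  by rewrite !addr_gt0// mulr_gt0.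
apply/negP; rewrite -leNgt le_eqVlt; apply/orP; left; apply/eqP.
by rewrite /kdet /sqnorm/=; ring.
Qed.

Lemma not_in_triangle_side p0 p1 p2 x y (s : R) : 0 < kdet p0 p1 p2 ->
  0 < s * (x - p0.1) -> 0 < s * (x - p1.1) -> 0 < s * (x - p2.1) ->
  0 <= kdet p0 p1 (x, y) -> 0 <= kdet p1 p2 (x, y) -> 0 <= kdet p2 p0 (x, y) ->
  False.
Proof.
move=> D h0 h1 h2 k01 k12 k20.
have e : kdet p0 p1 (x, y) * (s * (x - p2.1))
   + kdet p1 p2 (x, y) * (s * (x - p0.1))
   + kdet p2 p0 (x, y) * (s * (x - p1.1)) = 0.
  by rewrite /kdet /sqnorm/=; ring.
have eD : kdet p0 p1 (x, y) + kdet p1 p2 (x, y) + kdet p2 p0 (x, y)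
   = kdet p0 p1 p2.
  by rewrite /kdet /sqnorm/=; ring.
move: e eD k01 k12 k20.
move: (kdet p0 p1 _) (kdet p1 p2 _) (kdet p2 p0 _) => a b c e eD a0 b0 c0.
have ha := mulr_ge0 a0 (ltW h2); have hb := mulr_ge0 b0 (ltW h0).
have hc := mulr_ge0 c0 (ltW h1).
have z (u v : R) : 0 < v -> u * v = 0 -> u = 0.
  by move=> v0 /eqP; rewrite mulf_eq0 (gt_eqF v0) orbF => /eqP.
have a_0 : a = 0 by apply: z h2 _; lra.
have b_0 : b = 0 by apply: z h0 _; lra.
have c_0 : c = 0 by apply: z h1 _; lra.
by move: D; rewrite -eD a_0 b_0 c_0 !addr0 ltxx.
Qed.

Lemma not_in_quad_side p0 p1 p2 p3 x y (s : R) : ccw4 p0 p1 p2 p3 ->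
  0 < s * (x - p0.1) -> 0 < s * (x - p1.1) ->
  0 < s * (x - p2.1) -> 0 < s * (x - p3.1) -> ~ in_quad p0 p1 p2 p3 (x, y).
Proof.
move=> [D012 D123 D230 D301] h0 h1 h2 h3 [k01 k12 k23 k30].
have [k20|k20] := lerP 0 (kdet p2 p0 (x, y)).
  exact: (@not_in_triangle_side p0 p1 p2 x y s).
apply: (@not_in_triangle_side p2 p3 p0 x y s) => //.
by rewrite kdetC oppr_ge0 ltW.
Qed.

(** The side from p to q bounds the slice from below and the side from r to s
    from above; they come in this order because r and s, hence the point of the
    upper side on the slice, are on the left of the lower side. *)
Lemma slice_two p q r s x : 0 < p.2 -> 0 < q.2 -> 0 < r.2 -> 0 < s.2 ->
  p.1 < x -> x < q.1 -> s.1 < x -> x < r.1 ->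
  0 <= kdet p q r -> 0 <= kdet p q s ->
  [/\ 0 < height p q x, height p q x <= height r s x &
    forall y, 0 < y -> (0 <= kdet p q (x, y) /\ 0 <= kdet r s (x, y))
       <-> height p q x <= y <= height r s x].
Proof.
move=> p0 q0 r0 s0 px xq sx xr pqr pqs.
have pq := lt_trans px xq; have sr := lt_trans sx xr.
have lo0 : 0 < height p q x by apply: height_gt0 => //; rewrite !ltW.
have hi0 : 0 < height r s x.
  by rewrite heightC ?gt_eqF//; apply: height_gt0 => //; rewrite !ltW.
split=> //.
  rewrite -kdet_lower//.
  have c0 : 0 <= chord r s x - x ^+ 2.
    by rewrite chordC ?gt_eqF// ltW// chord_sub_gt0// !ltW.
  have := @kdet_height p q r s x; rewrite gt_eqF// => /(_ isT c0) e.
  have d0 : 0 < r.1 - s.1 by rewrite subr_gt0.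
  rewrite -(pmulr_lge0 _ d0) -opprB mulrN e opprD addr_ge0//.
    by rewrite -mulNr mulr_ge0// opprB subr_ge0 ltW.
  by rewrite -mulNr mulr_ge0// opprB subr_ge0 ltW.
move=> y y0; rewrite kdet_lower// kdet_upper//.
by split=> [[-> ->]//|/andP[]].
Qed.

(** Convexity excludes that the vertices alternate between the two sides of the
    slice. So either all of them are on one side and the slice is empty, or one
    vertex or two consecutive ones are separated from the others; then exactly
    two sides of the quadrilateral are crossed and they determine the slice. At
    the abscissas of the vertices, which form a null set, a side could be
    contained in the slice. *)
Lemma slice_quad p0 p1 p2 p3 x : ccw4 p0 p1 p2 p3 ->
  0 < p0.2 -> 0 < p1.2 -> 0 < p2.2 -> 0 < p3.2 ->
  x != p0.1 -> x != p1.1 -> x != p2.1 -> x != p3.1 ->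
  slice_spec p0 p1 p2 p3 x.
Proof.
have side (t : R) (b : bool) : x != t -> (t < x) = b ->
    0 < (-1) ^+ b * (t - x).
  move=> xt <-; case: (ltP t x) => h /=.
    by rewrite ?expr1 mulN1r opprB subr_gt0.
  by rewrite ?expr0 mul1r subr_gt0 lt_neqAle xt.
have neg (s t : R) : 0 < - s * (t - x) -> 0 < s * (x - t).
  by rewrite mulNr -mulrN opprB.
have corner a0 a1 a2 a3 (b : bool) : ccw4 a0 a1 a2 a3 ->
    0 < a0.2 -> 0 < a1.2 -> 0 < a2.2 -> 0 < a3.2 ->
    x != a0.1 -> x != a1.1 -> x != a2.1 -> x != a3.1 ->
    (a0.1 < x) = b -> (a1.1 < x) = ~~ b -> (a2.1 < x) = ~~ b ->
    (a3.1 < x) = ~~ b -> slice_spec a0 a1 a2 a3 x.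
  move=> ccw y0 y1 y2 y3 n0 n1 n2 n3 e0 e1 e2 e3; right.
  have [D012 D123 D230 D301] := ccw.
  have h0 := side _ _ n0 e0.
  have h1 := side _ _ n1 e1; have h3 := side _ _ n3 e3.
  have corn y : 0 <= kdet a0 a1 (x, y) -> 0 <= kdet a3 a0 (x, y) ->
      in_quad a0 a1 a2 a3 (x, y).
    apply: (@in_quad_corner _ _ _ _ _ _ ((-1) ^+ (~~ b))) => //.
    by apply: neg; move: h0; case: (b) => /=; rewrite ?expr0 ?expr1 ?opprK.
  case: b e0 e1 e2 e3 {h0 h1 h3 corn} (corn) => /= e0 e1 e2 e3 corn.
    have x1 : x < a1.1 by rewrite lt_neqAle n1 leNgt e1.
    have x3 : x < a3.1 by rewrite lt_neqAle n3 leNgt e3.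
    have [] := @slice_two a0 a1 a3 a0 x y0 y1 y3 y0 e0 x1 e0 x3.
    - by rewrite -kdet_rot kdet_rot kdet_rot ltW.
    - by rewrite /kdet; lra.
    move=> lo0 lohi h; exists (height a0 a1 x), (height a3 a0 x); split=> //.
      move=> y yp; rewrite -h//; split; first by case.
      by case; exact: corn.
    by rewrite /quad_density /edge_density e0 e1 e2 e3 /= ?mulr1n ?mulr0n; ring.
  have x0 : x < a0.1 by rewrite lt_neqAle n0 leNgt e0.
  have [] := @slice_two a3 a0 a0 a1 x y3 y0 y0 y1 e3 x0 e1 x0.
  - by rewrite /kdet; lra.
  - by rewrite ltW.
  move=> lo0 lohi h; exists (height a3 a0 x), (height a0 a1 x); split=> //.
    move=> y yp; rewrite -h//; split; first by case.
    by case => *; exact: corn.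
  by rewrite /quad_density /edge_density e0 e1 e2 e3 /= ?mulr1n ?mulr0n; ring.
have opposite a0 a1 a2 a3 : ccw4 a0 a1 a2 a3 ->
    0 < a0.2 -> 0 < a1.2 -> 0 < a2.2 -> 0 < a3.2 ->
    x != a0.1 -> x != a1.1 -> x != a2.1 -> x != a3.1 ->
    (a0.1 < x) = true -> (a1.1 < x) = true -> (a2.1 < x) = false ->
    (a3.1 < x) = false -> slice_spec a0 a1 a2 a3 x.
  move=> ccw y0 y1 y2 y3 n0 n1 n2 n3 e0 e1 e2 e3; right.
  have [D012 D123 D230 D301] := ccw.
  have x2 : x < a2.1 by rewrite lt_neqAle n2 leNgt e2.
  have x3 : x < a3.1 by rewrite lt_neqAle n3 leNgt e3.
  have [] := @slice_two a1 a2 a3 a0 x y1 y2 y3 y0 e1 x2 e0 x3.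
  - by rewrite ltW.
  - by rewrite kdet_rot ltW.
  move=> lo0 lohi h; exists (height a1 a2 x), (height a3 a0 x); split=> //.
    move=> y yp; rewrite -h//; split; first by case.
    by case => *; apply: (@in_quad_opposite _ _ _ _ _ _ 1) => //;
       rewrite mul1r subr_gt0.
  by rewrite /quad_density /edge_density e0 e1 e2 e3 /= ?mulr1n ?mulr0n; ring.
have empty (b : bool) : ccw4 p0 p1 p2 p3 ->
    x != p0.1 -> x != p1.1 -> x != p2.1 -> x != p3.1 ->
    (p0.1 < x) = b -> (p1.1 < x) = b -> (p2.1 < x) = b -> (p3.1 < x) = b ->
    slice_spec p0 p1 p2 p3 x.
  move=> ccw n0 n1 n2 n3 e0 e1 e2 e3; left; split.
    move=> y _; apply: (@not_in_quad_side _ _ _ _ _ _ (- (-1) ^+ b)) => //;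
    by apply: neg; rewrite opprK; exact: side.
  by rewrite /quad_density /edge_density e0 e1 e2 e3 subrr !mul0r !addr0.
have alternating a0 a1 a2 a3 : ccw4 a0 a1 a2 a3 ->
    x != a1.1 -> x != a3.1 ->
    (a0.1 < x) = true -> (a1.1 < x) = false -> (a2.1 < x) = true ->
    (a3.1 < x) = false -> slice_spec p0 p1 p2 p3 x.
  move=> ccw n1 n3 e0 e1 e2 e3; exfalso.
  apply: (@not_alternating _ _ _ _ x 1 ccw); rewrite mul1r subr_gt0//.
    by rewrite lt_neqAle n1 leNgt e1.
  by rewrite lt_neqAle n3 leNgt e3.
move=> c0 y0 y1 y2 y3 n0 n1 n2 n3.
have c1 := ccw4_rot c0; have c2 := ccw4_rot c1; have c3 := ccw4_rot c2.
case e0: (p0.1 < x); case e1: (p1.1 < x);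
  case e2: (p2.1 < x); case e3: (p3.1 < x);
  try solve [ exact: (empty true) | exact: (empty false)
  | exact: (corner _ _ _ _ true) | exact: (corner _ _ _ _ false)
  | exact: opposite
  | apply: slice_spec_rot; first [exact: (corner _ _ _ _ true)
      | exact: (corner _ _ _ _ false) | exact: opposite]
  | do 2 apply: slice_spec_rot; first [exact: (corner _ _ _ _ true)
      | exact: (corner _ _ _ _ false) | exact: opposite]
  | do 3 apply: slice_spec_rot; first [exact: (corner _ _ _ _ true)
      | exact: (corner _ _ _ _ false) | exact: opposite]
  | exact: (alternating p0 p1 p2 p3) | exact: (alternating p1 p2 p3 p0)].
Qed.

End Slices.

(** * The area as a boundary integral *)

Section QuadArea.
Variable R : realType.
Implicit Types p q z : R * R.
Local Notation mu := (@lebesgue_measure R).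
(* the measurable structure on the plane for which the area is defined *)
Local Notation R2 := (measurableTypeR R * measurableTypeR R)%type.

Lemma integral_inv_sqr (lo hi : R) : 0 < lo -> lo <= hi ->
  (\int[mu]_(y in `[lo, hi]) ((y ^+ 2)^-1)%:E)%E = (lo^-1 - hi^-1)%:E.
Proof.
move=> lo0 lohi.
have pos y : lo <= y <= hi -> y != 0.
  by move=> /andP[ly _]; rewrite gt_eqF// (lt_le_trans lo0).
have cf y : lo <= y <= hi -> {for y, continuous (fun y : R => (y ^+ 2)^-1)}.
  move=> /pos y0; apply: continuousV; first by rewrite expf_neq0.
  exact: exprn_continuous.
have dF (y : R) : lo <= y <= hi ->
    is_derive y 1 (fun y : R => -1 / y) ((y ^+ 2)^-1).
  move=> /pos yn0; apply: is_derive_eq (is_derive_divf yn0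
    (is_derive_constf (-1) y) (is_derive_id y 1)) _.
  by field.
rewrite -(fineK (x := (\int[mu]_(y in _) _)%E)); last first.
  by apply: integrable_fin_num => //; exact: integrable_continuous_itv.
have := Rintegral_FTC lohi dF cf; rewrite /Rintegral => ->.
by congr (_%:E); ring.
Qed.

(** The primitive of 1 / y along the geodesic, seen as a graph over the axis:
    the [edge_area] of the arc from p to the point of abscissa x. With y^2 =
    sqnorm p + m (x - p.1) - x^2, the numerator of the derivative equals (p.2 +
    y)^2 + (x - p.1)^2. *)
Lemma is_derive_edge_area p q (x : R) : 0 < p.2 -> 0 < q.2 -> p.1 < q.1 ->
  p.1 <= x <= q.1 ->
  is_derive x 1 (fun x => 2 * atan ((x - p.1) / (p.2 + height p q x)))
    (height p q x)^-1.
Proof.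
move=> p0 q0 pq px.
have c0 := chord_sub_gt0 p0 q0 pq px.
have h0 : 0 < height p q x by exact: height_gt0.
have h2 : height p q x ^+ 2 = chord p q x - x ^+ 2 by rewrite sqr_sqrtr// ltW.
have s0 : 0 < p.2 + height p q x by rewrite addr_gt0.
pose m := (sqnorm q - sqnorm p) / (q.1 - p.1).
have chE : (fun x : R => chord p q x - x ^+ 2)
    = (fun x => sqnorm p + m * (x - p.1) - x * x).
  by apply/funext => t; rewrite /chord /m; congr (_ + _ - _); rewrite mulrAC.
have dx : is_derive x 1 (fun t : R => t) 1 by exact: is_derive_id.
have dc : is_derive x 1 (fun x : R => chord p q x - x ^+ 2) (m - 2 * x).
  rewrite chE; apply: is_derive_eq (is_derive_subf (is_derive_addf
    (is_derive_constf (sqnorm p) x) (is_derive_mulcf m (is_derive_subf dx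
    (is_derive_constf p.1 x)))) (is_derive_mulf dx dx)) _.
  by ring.
have dh : is_derive x 1 (height p q) ((m - 2 * x) / (2 * height p q x)).
  have := @is_derive_compf _ Num.sqrt (fun x => chord p q x - x ^+ 2) _ _ _
    (is_derive1_sqrt c0) dc.
  by rewrite mulrC.
have sn : p.2 + height p q x != 0 by rewrite gt_eqF.
have dq := @is_derive_divf _ _ (fun x => p.2 + height p q x) _ _ _ sn
  (is_derive_subf dx (is_derive_constf p.1 x))
  (is_derive_addf (is_derive_constf p.2 x) dh).
apply: is_derive_eq (is_derive_mulcf 2 (is_derive_compf
  (is_derive1_atan _) dq)) _.
have h2' : height p q x ^+ 2 = p.1 ^+ 2 + p.2 ^+ 2 + m * (x - p.1) - x ^+ 2.
  by rewrite h2 (_ : chord p q x = sqnorm p + m * (x - p.1))// /chord /m mulrAC.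
move: h2' s0 h0 => /[swap] _; move: (height p q x) => h hE hp.
have y2 : p.2 ^+ 2 = h ^+ 2 - p.1 ^+ 2 - m * (x - p.1) + x ^+ 2.
  by rewrite hE; ring.
have sp : 0 < (p.2 + h) ^+ 2 + (x - p.1) ^+ 2.
  by rewrite ltr_pwDl ?sqr_ge0// exprn_gt0// addr_gt0.
have -> : 2 * ((1 + ((x - p.1) / (p.2 + h)) ^+ 2)^-1 *
    (((1 - 0) * (p.2 + h) - (x - p.1) * (0 + (m - 2 * x) / (2 * h))) /
       (p.2 + h) ^+ 2))
  = (2 * h * (p.2 + h) - (x - p.1) * (m - 2 * x))
    / (h * ((p.2 + h) ^+ 2 + (x - p.1) ^+ 2)).
  have : 0 < p.2 + h by rewrite addr_gt0.
  move=> s0; field; rewrite !gt_eqF//=; lra.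
have -> : 2 * h * (p.2 + h) - (x - p.1) * (m - 2 * x)
   = (p.2 + h) ^+ 2 + (x - p.1) ^+ 2.
  have -> : (p.2 + h) ^+ 2 = p.2 ^+ 2 + 2 * p.2 * h + h ^+ 2 by ring.
  by rewrite y2; ring.
by field; rewrite !gt_eqF//=.
Qed.

Lemma edge_density_itv p q : p.1 < q.1 ->
  edge_density p q = (fun x => (height p q x)^-1) \_ `]p.1, q.1].
Proof.
move=> pq; apply/funext => x; rewrite patchE mem_setE in_itv/= /edge_density.
case: (ltP p.1 x) => px /=; case: (ltP q.1 x) => qx /=.
- by rewrite subrr mul0r.
- by rewrite subr0 mul1r.
- by have := lt_trans pq qx; rewrite ltNge px.
- by rewrite subrr mul0r.
Qed.

Lemma edge_densityC p q : p.1 != q.1 ->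
  edge_density q p = (fun x => - edge_density p q x).
Proof.
move=> pq; apply/funext => x; rewrite /edge_density heightC 1?eq_sym//.
by rewrite -mulNr opprB.
Qed.

Lemma edge_density_integral p q : 0 < p.2 -> 0 < q.2 ->
  mu.-integrable setT (EFin \o edge_density p q) /\
  \int[mu]_x edge_density p q x = edge_area p q.
Proof.
have main p' q' : 0 < p'.2 -> 0 < q'.2 -> p'.1 < q'.1 ->
    mu.-integrable setT (EFin \o edge_density p' q') /\
    \int[mu]_x edge_density p' q' x = edge_area p' q'.
  move=> p0 q0 pq.
  have ch (x : R) : p'.1 <= x <= q'.1 ->
      {for x, continuous (fun x => (height p' q' x)^-1)}.
    move=> px; have h0 := height_gt0 p0 q0 pq px.
    apply: continuousV; first by rewrite gt_eqF.
    apply: (@continuous_comp _ _ _ (fun x => chord p' q' x - x ^+ 2) Num.sqrt);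
      last exact: sqrt_continuous.
    apply: continuousB; last exact: exprn_continuous.
    apply: continuousD; first exact: cst_continuous.
    apply: continuousM; last exact: cst_continuous.
    apply: continuousM; first exact: cst_continuous.
    by apply: continuousB; [exact: cvg_id|exact: cst_continuous].
  have ih : mu.-integrable `]p'.1, q'.1]
      (EFin \o (fun x => (height p' q' x)^-1)).
    apply: integrableS (integrable_continuous_itv ch) => //.
    exact: subset_itv_oc_cc.
  rewrite edge_density_itv//; split.
    have := (@integrable_mkcond _ _ _ mu `]p'.1, q'.1]%classic
      (EFin \o (fun x => (height p' q' x)^-1)) (measurable_itv _)).1 ih.
    by rewrite restrict_EFin.
  rewrite -Rintegral_mkcond Rintegral_itv_obnd_cbnd//.
  rewrite (Rintegral_FTC (ltW pq) (fun x => is_derive_edge_area p0 q0 pq) ch).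
  rewrite subrr mul0r atan0 mulr0 subr0 /edge_area.
  congr (2 * atan (_ / (_ + _))).
  have -> : height p' q' q'.1 = Num.sqrt (q'.2 ^+ 2).
    rewrite /height /chord mulfK ?subr_eq0 ?gt_eqF// /sqnorm.
    by congr Num.sqrt; ring.
  by rewrite sqrtr_sqr gtr0_norm.
move=> p0 q0; have [pq|qp|pq] := ltgtP p.1 q.1; first exact: main.
  have [i e] := main _ _ q0 p0 qp.
  rewrite edge_densityC ?lt_eqF//; split.
    by apply: eq_integrable (integrableN i) => // x _; rewrite /= EFinN.
  have -> : edge_area p q = (-1) * edge_area q p.
    rewrite /edge_area (_ : (q.1 - p.1) / _ = - ((p.1 - q.1) / (q.2 + p.2))).
      by rewrite atanN; ring.
    by rewrite -mulNr opprB [p.2 + _]addrC.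
  rewrite -e -RintegralZl//; apply: eq_Rintegral => x _; by rewrite mulN1r.
have d0 : edge_density p q = cst 0.
  by apply/funext => x; rewrite /edge_density pq subrr mul0r.
rewrite d0; split; first exact: integrable0.
by rewrite Rintegral_cst//= mul0r /edge_area pq subrr mul0r atan0 mulr0.
Qed.

Definition quad_region p0 p1 p2 p3 : set (R * R) :=
  [set z | 0 < z.2 /\ in_quad p0 p1 p2 p3 z].

Lemma measurable_kdet_ge0 p q :
  measurable ([set z | 0 <= kdet p q z] : set R2).
Proof.
have mk : measurable_fun setT (kdet p q : R2 -> R).
  have m1 : measurable_fun setT (fun z : R2 => z.1 : R).
    exact: measurable_fst.
  have m2 : measurable_fun setT (fun z : R2 => z.2 : R).
    exact: measurable_snd.
  apply: measurable_funB.
    apply: measurable_funM; apply: measurable_funB => //.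
    by apply: measurable_funD; exact: measurable_funX.
  by apply: measurable_funM => //; exact: measurable_funB.
have -> : [set z | 0 <= kdet p q z] = [set: R2] `&` kdet p q @^-1` `[0, +oo[.
  by rewrite setTI; apply/seteqP; split => z /=; rewrite in_itv/= andbT.
exact: mk.
Qed.

Lemma measurable_quad_region p0 p1 p2 p3 :
  measurable (quad_region p0 p1 p2 p3 : set R2).
Proof.
have -> : quad_region p0 p1 p2 p3 =
    ([set: R2] `&` snd @^-1` `]0, +oo[) `&`
    ([set z | 0 <= kdet p0 p1 z] `&` [set z | 0 <= kdet p1 p2 z] `&`
     ([set z | 0 <= kdet p2 p3 z] `&` [set z | 0 <= kdet p3 p0 z])).
  rewrite setTI; apply/seteqP; split => z /=; rewrite in_itv/= andbT.
    by move=> [z0 [? ? ? ?]].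
  by move=> [z0 [[? ?] [? ?]]].
apply: measurableI; first by apply: measurable_snd.
by apply: measurableI; apply: measurableI; exact: measurable_kdet_ge0.
Qed.

(** By the theorem of Tonelli the area is the integral over x of the integrals
    over the slices, which are almost everywhere the sums of the [edge_density]
    of the sides. *)
Lemma quad_region_area p0 p1 p2 p3 : ccw4 p0 p1 p2 p3 ->
  0 < p0.2 -> 0 < p1.2 -> 0 < p2.2 -> 0 < p3.2 ->
  harea (quad_region p0 p1 p2 p3) =
  edge_area p0 p1 + edge_area p1 p2 + edge_area p2 p3 + edge_area p3 p0.
Proof.
move=> ccw y0 y1 y2 y3; set Q := quad_region _ _ _ _.
have mQ : measurable (Q : set R2) by exact: measurable_quad_region.
pose h (y : R) := (y ^+ 2)^-1; pose D : set R := `]0, +oo[%classic.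
have mh : measurable_fun setT (h \_ D).
  apply: (measurable_restrictT h (measurable_itv `]0, +oo[)).1.
  apply: open_continuous_measurable_fun; first exact: interval_open.
  move=> y; rewrite inE/= in_itv/= andbT => y_gt0.
  apply: (@continuousV _ _ (fun y : R => y ^+ 2)).
    by rewrite expf_neq0// gt_eqF.
  exact: exprn_continuous.
pose k (z : R2) : R := (h \_ D) z.2 * \1_Q z.
have mk : measurable_fun setT k.
  apply: measurable_funM; last exact: measurable_indic.
  by apply: measurableT_comp => //; exact: measurable_snd.
have k0 (z : R2) : 0 <= k z.
  by rewrite mulr_ge0// patchE; case: ifP => // _; rewrite invr_ge0 sqr_ge0.
have kQ z : ((fun z : R2 => ((z.2 : R) ^+ 2)^-1) \_ Q) z = k z.
  rewrite /k indicE !patchE; case: ifPn => zQ; last by rewrite mulr0.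
  rewrite mulr1 ifT// inE /D/= in_itv/= andbT.
  by move: zQ; rewrite inE => -[].
pose F := fubini_F mu (EFin \o k).
have mF : measurable_fun setT F.
  apply: measurable_fun_fubini_tonelli_F; first exact/measurable_EFinP.
  by move=> z; rewrite lee_fin.
have [i0 e0] := edge_density_integral y0 y1.
have [i1 e1] := edge_density_integral y1 y2.
have [i2 e2] := edge_density_integral y2 y3.
have [i3 e3] := edge_density_integral y3 y0.
have i01 : mu.-integrable setT (EFin \o
    (fun x => edge_density p0 p1 x + edge_density p1 p2 x)).
  by have := integrableD measurableT i0 i1; apply: eq_integrable.
have i012 : mu.-integrable setT (EFin \o (fun x => edge_density p0 p1 x
    + edge_density p1 p2 x + edge_density p2 p3 x)).
  by have := integrableD measurableT i01 i2; apply: eq_integrable.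
have iG : mu.-integrable setT (EFin \o quad_density p0 p1 p2 p3).
  by have := integrableD measurableT i012 i3; apply: eq_integrable.
have FG x : x != p0.1 -> x != p1.1 -> x != p2.1 -> x != p3.1 ->
    F x = (quad_density p0 p1 p2 p3 x)%:E.
  move=> n0 n1 n2 n3.
  have inQ y : Q (x, y) <-> 0 < y /\ in_quad p0 p1 p2 p3 (x, y) by [].
  have [[emp ->]|[lo [hi [lo0 lohi sl ->]]]] :=
    slice_quad ccw y0 y1 y2 y3 n0 n1 n2 n3.
    apply: integral0_eq => y _; rewrite /= /k indicE.
    case: (boolP ((x, y) \in Q)); rewrite ?mulr0// inE => /inQ[y_gt0 xy].
    by case: (emp y y_gt0).
  have kE : (fun y : R => (k (x, y))%:E) =
      (fun y : R => ((y ^+ 2)^-1)%:E) \_ `[lo, hi].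
    apply/funext => y; rewrite -kQ !patchE.
    have -> : ((x, y) \in Q) = (y \in `[lo, hi]%classic).
      apply/idP/idP; rewrite !inE/= in_itv/=.
        by move=> [y_gt0 xy]; apply/(sl y y_gt0).
      move=> lyh; have y_gt0 : 0 < y.
        by case/andP: lyh => + _; exact: lt_le_trans.
      by split => //; apply/(sl y y_gt0).
    by case: ifP.
  rewrite -integral_inv_sqr// [in RHS]integral_mkcond -kE.
  by [].
have areaE : harea Q = \int[mu]_x quad_density p0 p1 p2 p3 x.
  rewrite /harea Rintegral_mkcond /Rintegral; congr fine.
  under eq_integral do rewrite kQ.
  rewrite (fubini_tonelli1 (EFin \o k)); last 2 first.
  - exact/measurable_EFinP.
  - by move=> z; rewrite lee_fin.
  apply: ae_eq_integral => //.
    by case/integrableP: iG.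
  have cN : countable [set p0.1; p1.1; p2.1; p3.1].
    apply: finite_set_countable; rewrite !finite_setU.
    by do !split; exact: finite_set1.
  exists [set p0.1; p1.1; p2.1; p3.1]; split.
  - exact: countable_measurable.
  - exact: countable_lebesgue_measure0.
  move=> x /= nx; apply: contrapT => nin; apply: nx => _.
  by apply: FG; apply/eqP => xE; apply: nin; rewrite /= xE; tauto.
rewrite areaE /quad_density -e0 -e1 -e2 -e3.
by rewrite RintegralD// RintegralD// RintegralD.
Qed.

End QuadArea.

(** * Orientation of a convex polygon with four vertices *)

Section PolygonRegion.
Variables (R : realType) (P : 'I_4 -> R * R).
Hypothesis convP : convex_polygon P.

Lemma notin_side (i : 'I_4) : (i \notin [:: ordS i; ordS (ordS i)])
  * (ordS (ordS i) \notin [:: i; ordS i]).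
Proof.
by rewrite !inE; split; apply/norP; split; case: i => [[|[|[|[|//]]]]].
Qed.

(** If two consecutive vertices coincided, the line through the next side would
    contain a vertex that has to be strictly on one side of it. *)
Lemma convex_polygon_distinct (i : 'I_4) : P i <> P (ordS i).
Proof.
move=> PE; have [l [[_ l0] _ sides]] := convP.2 (ordS i).
have := sides i i (notin_side i).1 (notin_side i).1.
by rewrite PE l0 mulr0 ltxx.
Qed.

Lemma convex_polygon_kdet (i j j' : 'I_4) :
  j \notin [:: i; ordS i] -> j' \notin [:: i; ordS i] ->
  0 < kdet (P i) (P (ordS i)) (P j) * kdet (P i) (P (ordS i)) (P j').
Proof.
move=> jN jN'; have [l [li lSi sides]] := convP.2 i.
have [k k0 kE] := kdet_hside li lSi (@convex_polygon_distinct i).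
rewrite !kE.
have -> : k * hside l (P j) * (k * hside l (P j'))
  = k ^+ 2 * (hside l (P j) * hside l (P j')) by ring.
by rewrite mulr_gt0 ?sides// exprn_even_gt0.
Qed.

Lemma ordS4 : (ordS 0 = 1 :> 'I_4) * (ordS 1 = 2 :> 'I_4)
  * (ordS 2 = 3 :> 'I_4) * (ordS 3 = 0 :> 'I_4).
Proof. by do !split; exact: val_inj. Qed.

(** The line through a side is unique, and its [hside] is proportional to
    [kdet], so the conditions that define the region are those on the
    determinants; the sign sg is that of the orientation. *)
Lemma polygon_region_kdet (sg : R) : sg ^+ 2 = 1 ->
  (forall i j, j \notin [:: i; ordS i] ->
     0 < sg * kdet (P i) (P (ordS i)) (P j)) ->
  polygon_region P =
    [set z | uhp z /\ forall i, 0 <= sg * kdet (P i) (P (ordS i)) z].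
Proof.
move=> sg2 orient; apply/seteqP; split => z /= [z0 hz]; split => // i.
  have [l [li lSi _]] := convP.2 i.
  have [k k0 kE] := kdet_hside li lSi (@convex_polygon_distinct i).
  set j := ordS (ordS i).
  rewrite -(pmulr_lge0 _ (orient i j (notin_side i).2)) !kE.
  have -> : sg * (k * hside l z) * (sg * (k * hside l (P j)))
    = sg ^+ 2 * k ^+ 2 * (hside l z * hside l (P j)) by ring.
  by rewrite sg2 mul1r mulr_ge0 ?sqr_ge0//; exact: (hz i).
move=> l li lSi j.
have [k k0 kE] := kdet_hside li lSi (@convex_polygon_distinct i).
have kj : 0 <= sg * kdet (P i) (P (ordS i)) (P j).
  have [jN|] := boolP (j \notin [:: i; ordS i]); first by rewrite ltW ?orient.
  rewrite negbK !inE => /orP[] /eqP ->.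
    by rewrite (_ : kdet _ _ _ = 0) ?mulr0// /kdet; ring.
  by rewrite (_ : kdet _ _ _ = 0) ?mulr0// /kdet; ring.
have k2 : 0 < k ^+ 2 by rewrite exprn_even_gt0.
rewrite -(pmulr_rge0 _ k2).
have -> : k ^+ 2 * (hside l z * hside l (P j))
  = sg ^+ 2 * ((k * hside l z) * (k * hside l (P j))) by rewrite sg2; ring.
rewrite -!kE (_ : sg ^+ 2 * _ = (sg * kdet (P i) (P (ordS i)) z)
  * (sg * kdet (P i) (P (ordS i)) (P j))); last by ring.
by rewrite mulr_ge0.
Qed.

Lemma ord4P (i : 'I_4) : [\/ i = 0, i = 1, i = 2 | i = 3].
Proof.
case: i => [[|[|[|[|//]]]] ilt].
- by apply: Or41; exact: val_inj.
- by apply: Or42; exact: val_inj.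
- by apply: Or43; exact: val_inj.
- by apply: Or44; exact: val_inj.
Qed.

Lemma polygon_region_sign (sg : R) : sg ^+ 2 = 1 ->
  0 < sg * kdet (P 0) (P 1) (P 2) -> 0 < sg * kdet (P 1) (P 2) (P 3) ->
  0 < sg * kdet (P 2) (P 3) (P 0) -> 0 < sg * kdet (P 3) (P 0) (P 1) ->
  polygon_region P = [set z | uhp z /\
    [/\ 0 <= sg * kdet (P 0) (P 1) z, 0 <= sg * kdet (P 1) (P 2) z,
        0 <= sg * kdet (P 2) (P 3) z & 0 <= sg * kdet (P 3) (P 0) z]].
Proof.
move=> sg2 h0 h1 h2 h3; rewrite (@polygon_region_kdet sg)//; last first.
  move=> i j jN.
  have [j' j'N jp] : exists2 j' : 'I_4, j' \notin [:: i; ordS i] &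
      0 < sg * kdet (P i) (P (ordS i)) (P j').
    by case: (ord4P i) => ->; rewrite !ordS4;
      [exists 2|exists 3|exists 0|exists 1].
  rewrite -(pmulr_lgt0 _ jp); have := convex_polygon_kdet jN j'N.
  set a := kdet _ _ (P j); set b := kdet _ _ (P j').
  have -> : sg * a * (sg * b) = sg ^+ 2 * (a * b) by ring.
  by rewrite sg2 mul1r.
apply/seteqP; split => z /= [z0 hz]; split => //.
  by have := (hz 0, hz 1, hz 2, hz 3); rewrite !ordS4 => -[[[? ?] ?] ?].
by case: hz => ? ? ? ? i; case: (ord4P i) => ->; rewrite ordS4.
Qed.

(** For each side, convexity equates the signs of two of the four determinants
    of consecutive vertices, so these four have one sign. If it is negative,
    listing the vertices backwards makes it positive. *)
Lemma polygon_orientation :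
  (ccw4 (P 0) (P 1) (P 2) (P 3) /\
   polygon_region P = quad_region (P 0) (P 1) (P 2) (P 3)) \/
  (ccw4 (P 3) (P 2) (P 1) (P 0) /\
   polygon_region P = quad_region (P 3) (P 2) (P 1) (P 0)).
Proof.
have s0 := @convex_polygon_kdet 0 2 3.
have s1 := @convex_polygon_kdet 1 3 0.
have s3 := @convex_polygon_kdet 3 1 2.
rewrite !ordS4 in s0 s1 s3.
move: s0 s1 s3 => /(_ isT isT) s0 /(_ isT isT) s1 /(_ isT isT) s3.
rewrite (kdet_rot (P 3) (P 0) (P 1)) in s0.
rewrite (kdet_rot (P 0) (P 1) (P 2)) in s1.
rewrite (kdet_rot (P 2) (P 3) (P 0)) in s3.
case: (ltrgtP (kdet (P 0) (P 1) (P 2)) 0) => [A|A|A]; last first.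
- by move: s0; rewrite A mul0r ltxx.
- have B : 0 < kdet (P 1) (P 2) (P 3) by rewrite -(pmulr_lgt0 _ A).
  have E : 0 < kdet (P 3) (P 0) (P 1) by rewrite -(pmulr_rgt0 _ A).
  have C : 0 < kdet (P 2) (P 3) (P 0) by rewrite -(pmulr_rgt0 _ E).
  left; split=> //; rewrite (@polygon_region_sign 1) ?mul1r ?expr1n//.
  by apply/seteqP; split => z /=; rewrite !mul1r.
have B : kdet (P 1) (P 2) (P 3) < 0 by rewrite -(nmulr_lgt0 _ A).
have E : kdet (P 3) (P 0) (P 1) < 0 by rewrite -(nmulr_rgt0 _ A).
have C : kdet (P 2) (P 3) (P 0) < 0 by rewrite -(nmulr_rgt0 _ E).
right; split.
  by split; rewrite kdetC oppr_gt0 kdet_rot // ?kdet_rot.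
rewrite (@polygon_region_sign (-1)) ?mulN1r ?oppr_gt0 ?sqrrN ?expr1n//.
apply/seteqP; split => z /= [z0 [h0 h1 h2 h3]]; split => //.
  by split; rewrite kdetC -mulN1r.
by split; rewrite mulN1r -kdetC.
Qed.

End PolygonRegion.

Theorem theorem4p4 (R : realType) (P : 'I_4 -> R * R) (a b c d s S : R)
    (hP : cyclic_polygon P)
    (ha : a = side_length P 0) (hb : b = side_length P 1)
    (hc : c = side_length P 2) (hd : d = side_length P 3)
    (hs : s = (a + b + c + d) / 2)
    (hS : S = harea (polygon_region P)) :
  sin (S / 4) ^+ 2 =
    (sinh ((s - a) / 2) * sinh ((s - b) / 2)
       * sinh ((s - c) / 2) * sinh ((s - d) / 2))
    / (cosh (a / 2) * cosh (b / 2) * cosh (c / 2) * cosh (d / 2)).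
Proof.
case: hP => convP [C [/cyclic_linear[al [be [de lin]]] CP]].
have y0 i : 0 < (P i).2 by exact: convP.1.
have linP i : (P i).2 = al * sqnorm (P i) + be * (P i).1 + de.
  by apply: lin; [exact: y0|exact: CP].
rewrite /side_length !ordS4 in ha hb hc hd.
have sE i j (t : R) : t = hdist (P i) (P j) ->
    sinh (t / 2) ^+ 2 = sqdist (P i) (P j) / (4 * (P i).2 * (P j).2).
  by move=> ->; exact: sinh_hdist.
have t0 i j (t : R) : t = hdist (P i) (P j) -> 0 <= t.
  by move=> ->; exact: hdist_ge0.
case: (polygon_orientation convP) => -[ccw rE].
  apply: (@sin_sqr_sum_edge_area _ (P 0) (P 1) (P 2) (P 3) al be de) => //.
  - by move=> p; rewrite !inE => /or4P[] /eqP ->.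
  - by split; [exact: t0 ha|exact: t0 hb|exact: t0 hc|exact: t0 hd].
  - exact: sE.
  - exact: sE.
  - exact: sE.
  - exact: sE.
  - by rewrite hS rE quad_region_area.
have sN i j (t : R) : t = hdist (P j) (P i) ->
    sinh (t / 2) ^+ 2 = sqdist (P i) (P j) / (4 * (P i).2 * (P j).2).
  move=> /sE ->; rewrite (_ : sqdist (P j) _ = sqdist (P i) (P j)).
    by rewrite mulrAC.
  by rewrite /sqdist; ring.
have := @sin_sqr_sum_edge_area _ (P 3) (P 2) (P 1) (P 0) al be de c b a d s S.
have -> : (sinh ((s - a) / 2) * sinh ((s - b) / 2)
       * sinh ((s - c) / 2) * sinh ((s - d) / 2))
    / (cosh (a / 2) * cosh (b / 2) * cosh (c / 2) * cosh (d / 2))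
  = (sinh ((s - c) / 2) * sinh ((s - b) / 2)
       * sinh ((s - a) / 2) * sinh ((s - d) / 2))
    / (cosh (c / 2) * cosh (b / 2) * cosh (a / 2) * cosh (d / 2)).
  by congr (_ / _); ring.
apply=> //.
- by move=> p; rewrite !inE => /or4P[] /eqP ->.
- by split; [exact: t0 hc|exact: t0 hb|exact: t0 ha|exact: t0 hd].
- exact: sN.
- exact: sN.
- exact: sN.
- exact: sN.
- by rewrite hs; ring.
- by rewrite hS rE quad_region_area.
Qed.
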